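(* Let $d\in\{2,3\}$, $\nu>0$, and let $\Omega\subset\mathbb{R}^d$ be open and symmetric with respect to the hyperplane $\{x=0\}$ ($x$ being the first coordinate). Set $\Gamma=\bar\Omega\cap\{x=0\}$, $\Omega_1=\Omega\cap\{x<0\}$, $\Omega_2=\Omega\cap\{x>0\}$. Consider the Stokes problem $$-\nu\Delta\vec u-\nabla p=\vec f,\qquad \nabla\cdot\vec u=0\quad\text{in }\Omega,\qquad \vec u=0\ \text{ on }\partial\Omega,$$ and the following algorithm. Start with initial guesses $(\vec u_i^0,p_i^0)$ on $\Omega_i$, $i=1,2$, satisfying $\vec u^0_{1,\tau_1}=\vec u^0_{2,\tau_2}$ and $\vec\sigma_{n_1}(\vec u^0_1,p^0_1)=-\vec\sigma_{n_2}(\vec u^0_2,p^0_2)$ on $\Gamma$. For $k\ge 0$ and $i=1,2$: Correction step: $(\bar{\vec w}_i^{k+1},\bar q_i^{k+1})$ solves $$-\nu\Delta\bar{\vec w}_i^{k+1}-\nabla\bar q_i^{k+1}=0,\quad \nabla\cdot\bar{\vec w}_i^{k+1}=0\ \text{ in }\Omega_i,$$ $$\bar{\vec w}^{k+1}_{i,n_i}=(-1)^i\,\tfrac12\big(\vec u^k_{1,n_1}-\vec u^k_{2,n_2}\big)\ \text{ on }\Gamma,$$ $$\vec\sigma_{\tau_i}(\bar{\vec w}_i^{k+1},\bar q_i^{k+1})=-\tfrac12\big(\vec\sigma_{\tau_1}(\vec u_1^k,p_1^k)+\vec\sigma_{\tau_2}(\vec u_2^k,p_2^k)\big)\ \text{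 on }\Gamma,$$ with $\bar{\vec w}_i^{k+1}=0$ on $\partial\Omega_i\setminus\Gamma$. Update step: $(\vec u_i^{k+1},p_i^{k+1})$ solves $$-\nu\Delta\vec u_i^{k+1}-\nabla p_i^{k+1}=\vec f,\quad \nabla\cdot\vec u_i^{k+1}=0\ \text{ in }\Omega_i,$$ $$\vec u^{k+1}_{i,\tau_i}=\vec u^k_{i,\tau_i}+\tfrac12\big(\bar{\vec w}^{k+1}_{1,\tau_1}+\bar{\vec w}^{k+1}_{2,\tau_2}\big)\ \text{ on }\Gamma,$$ $$\vec\sigma_{n_i}(\vec u_i^{k+1},p_i^{k+1})=\vec\sigma_{n_i}(\vec u_i^{k},p_i^{k})+(-1)^{i-1}\tfrac12\big(\vec\sigma_{n_1}(\bar{\vec w}_1^{k+1},\bar q_1^{k+1})-\vec\sigma_{n_2}(\bar{\vec w}_2^{k+1},\bar q_2^{k+1})\big)\ \text{ on }\Gamma,$$ with $\vec u_i^{k+1}=0$ on $\partial\Omega_i\setminus\Gamma$. Then the algorithm converges in two steps: $(\vec u_i^2,p_i^2)$, $i=1,2$, are the restrictions to $\Omega_i$ of a solution $(\vec u,p)$ of the Stokes problem on $\Omega$ (the pressure being understood up to a global additive constant whenever the Stokes problem determines it only up to such a constant).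
   Context: On $\Gamma$, $n_i$ is the unit normal pointing outward from $\Omega_i$, so $n_1=-n_2$. For a vector field $\vec a$ on $\Gamma$ the normal part $\vec a_{n_i}=(\vec a\cdot n_i)n_i$ and the tangential part $\vec a_{\tau_i}=\vec a-(\vec a\cdot n_i)n_i$ are understood as vectors. The stress on the interface seen from $\Omega_i$, for a velocity $\vec u$ and pressure $p$ on $\Omega_i$, is $\vec\sigma(\vec u,p)=\nu\,\partial_{n_i}\vec u+p\,n_i$ (with the sign convention of the pressure in the momentum equation $-\nu\Delta\vec u-\nabla p=\vec f$); $\vec\sigma_{n_i}(\vec u,p)$ and $\vec\sigma_{\tau_i}(\vec u,p)$ are its normal and tangential parts. The subproblems are treated as well-posed problems (pressure up to an additive constant when the boundary conditions do not fix it), with the data and solutions regular enough that all traces make sense, so that all iterates are defined.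
   Formalization: Added hypothesis: every point of the boundary of Ω on the hyperplane {x=0} is a limit of boundary points off it; for a box minus a slit in {x=0} the claim fails, since the iterates need not vanish on the slit, which is part of ∂Ω. *)

(* Defs.v *)
From HB Require Import structures.
From mathcomp Require Import all_boot all_order all_algebra.
From mathcomp Require Import all_classical all_reals all_analysis.

Set Implicit Arguments.
Unset Strict Implicit.
Unset Printing Implicit Defensive.

Import Order.TTheory GRing.Theory Num.Theory.
Import numFieldNormedType.Exports.

Local Open Scope classical_set_scope.
Local Open Scope ring_scope.

(* Points and vectors are row vectors of length n = d.+1, so that the first
   coordinate [ord0] always exists.  Fields are total functions; only their
   values on the closure of the relevant open set are meaningful.  The
   subdomains are numbered i = 1, 2. *)

Section Stokes.
Variables (R : realType) (d : nat).
Notation E := 'rV[R]_d.+1.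

Definition basis_vec (j : 'I_d.+1) : E := delta_mx 0 j.

Definition dotv (a b : E) : R := \sum_(j < d.+1) a 0 j * b 0 j.

Definition mirror (x : E) : E :=
  \row_j (if j == ord0 then - x 0 j else x 0 j).

Definition mirror_velocity (u : E -> E) : E -> E :=
  fun x => mirror (u (mirror x)).

Definition mirror_pressure (p : E -> R) : E -> R := fun x => p (mirror x).

Definition hyperplane : set E := [set x | x 0 ord0 = 0].

Definition boundary (A : set E) : set E := closure A `\` interior A.

Definition interface (Omega : set E) : set E := closure Omega `&` hyperplane.

Definition subdomain (Omega : set E) (i : nat) : set E :=
  Omega `&` [set x | if i == 1%N then x 0 ord0 < 0 else 0 < x 0 ord0].

Definition is_side (i : nat) : Prop := i = 1%N \/ i = 2%N.

(* Omega lies on both sides of no piece of its boundary contained in the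
   hyperplane; this holds for Lipschitz domains, and as soon as Omega is the
   interior of its closure.  On a slit contained in [hyperplane] the algorithm
   imposes the interface conditions while the global problem asks for u = 0. *)
Definition no_slit (Omega : set E) : Prop :=
  boundary Omega `&` hyperplane
    `<=` closure (boundary Omega `\` hyperplane).

(* Meant for an open set A: f and all its iterated partial derivatives of order
   at most k exist and are continuous at every point of A. *)
Fixpoint Ck (W : normedModType R) (k : nat) (A : set E) (f : E -> W) : Prop :=
  (forall x, A x -> {for x, continuous f}) /\
  match k with
  | 0%N => True
  | k'.+1 => forall j : 'I_d.+1,
      (forall x, A x -> derivable f x (basis_vec j)) /\
      Ck k' A ('D_(basis_vec j) f)
  end.

(* C^k up to those boundary points that belong to S, in the sense of the
   existence of a C^k extension to a neighbourhood.  When S lies in the closure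
   of its interior, the derivatives of f on S are determined by the values of f
   on that interior, so they are the traces of the derivatives of f. *)
Definition Ck_upto (W : normedModType R) (k : nat) (S : set E) (f : E -> W) :
    Prop :=
  exists A : set E, [/\ open A, S `<=` A & Ck k A f].

Definition laplacian (u : E -> E) (x : E) : E :=
  \sum_(j < d.+1) 'D_(basis_vec j) ('D_(basis_vec j) u) x.

Definition gradient (p : E -> R) (x : E) : E :=
  \row_j 'D_(basis_vec j) p x.

Definition divergence (u : E -> E) (x : E) : R :=
  \sum_(j < d.+1) ('D_(basis_vec j) u x) 0 j.

Definition stokes_equations (nu : R) (D : set E) (f u : E -> E) (p : E -> R) :
    Prop :=
  forall x, D x ->
    - (nu *: laplacian u x) - gradient p x = f x /\ divergence u x = 0.

Definition stokes_solution (nu : R) (Omega : set E) (f u : E -> E)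
    (p : E -> R) : Prop :=
  [/\ Ck 2 Omega u, Ck 1 Omega p, {within closure Omega, continuous u},
      stokes_equations nu Omega f u p &
      forall x, boundary Omega x -> u x = 0].

(* n_1 = e_1 and n_2 = - e_1, outward from x < 0 and x > 0 respectively. *)
Definition normal (i : nat) : E := (-1) ^+ i.-1 *: basis_vec ord0.

Definition normal_part (i : nat) (a : E) : E := dotv a (normal i) *: normal i.

Definition tangential_part (i : nat) (a : E) : E := a - normal_part i a.

Definition stress (nu : R) (i : nat) (u : E -> E) (p : E -> R) (x : E) : E :=
  nu *: 'D_(normal i) u x + p x *: normal i.

Definition sigma_n nu i u p x : E := normal_part i (stress nu i u p x).

Definition sigma_tau nu i u p x : E := tangential_part i (stress nu i u p x).

Definition has_traces (Omega : set E) (i : nat) (u : E -> E) (p : E -> R) :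
    Prop :=
  Ck_upto 1 (subdomain Omega i `|` interface Omega) u /\
  Ck_upto 0 (subdomain Omega i `|` interface Omega) p.

(* Classical regularity.  Second derivatives of u and first derivatives of p
   are only required up to the relative interior of the interface, not at the
   points where the interface meets the boundary of Omega. *)
Definition regular (Omega : set E) (i : nat) (u : E -> E) (p : E -> R) : Prop :=
  [/\ has_traces Omega i u p,
      {within closure (subdomain Omega i), continuous u},
      Ck_upto 2 (subdomain Omega i `|` (interface Omega `&` Omega)) u &
      Ck_upto 1 (subdomain Omega i `|` (interface Omega `&` Omega)) p].

(* The spaces V 1, V 2 in which the subproblems on the two halves are posed.
   For bounded Omega one can take V i := regular Omega i; for unbounded Omega
   V also records the conditions at infinity. *)
Definition solution_spaces (Omega : set E)
    (V : nat -> (E -> E) -> (E -> R) -> Prop) : Prop :=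
  [/\ forall i u p, is_side i -> V i u p -> regular Omega i u p,
      forall i (a : R) u p v q, is_side i -> V i u p -> V i v q ->
        V i (fun x => a *: u x + v x) (fun x => a * p x + q x),
      forall u p, V 1%N u p -> V 2%N (mirror_velocity u) (mirror_pressure p) &
      forall u p, V 2%N u p -> V 1%N (mirror_velocity u) (mirror_pressure p)].

Definition correction_problem (nu : R) (Omega : set E) (i : nat)
    (g h w : E -> E) (q : E -> R) : Prop :=
  [/\ stokes_equations nu (subdomain Omega i) (fun=> 0) w q,
      forall x, interface Omega x -> normal_part i (w x) = g x,
      forall x, interface Omega x -> sigma_tau nu i w q x = h x &
      forall x, (boundary (subdomain Omega i) `\` interface Omega) x ->
        w x = 0].

Definition update_problem (nu : R) (Omega : set E) (i : nat)
    (f g h u : E -> E) (p : E -> R) : Prop :=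
  [/\ stokes_equations nu (subdomain Omega i) f u p,
      forall x, interface Omega x -> tangential_part i (u x) = g x,
      forall x, interface Omega x -> sigma_n nu i u p x = h x &
      forall x, (boundary (subdomain Omega i) `\` interface Omega) x ->
        u x = 0].

(* Uniqueness part of well-posedness; solvability is only needed for the data
   met by the algorithm, where it is the existence of the iterates.  Once the
   velocity is unique, the momentum equation fixes the gradient of the
   pressure, hence the pressure up to a constant on each component. *)
Definition correction_unique (nu : R) (Omega : set E)
    (V : nat -> (E -> E) -> (E -> R) -> Prop) : Prop :=
  forall i g h w q w' q', is_side i -> V i w q -> V i w' q' ->
    correction_problem nu Omega i g h w q ->
    correction_problem nu Omega i g h w' q' ->
    forall x, subdomain Omega i x -> w x = w' x.

Definition update_unique (nu : R) (Omega : set E) (f : E -> E)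
    (V : nat -> (E -> E) -> (E -> R) -> Prop) : Prop :=
  forall i g h u p u' p', is_side i -> V i u p -> V i u' p' ->
    update_problem nu Omega i f g h u p ->
    update_problem nu Omega i f g h u' p' ->
    forall x, subdomain Omega i x -> u x = u' x.

(* In the algorithm, the first argument of u, p, w, q is the subdomain and the
   second one the iteration. *)

Definition initial_guess (nu : R) (Omega : set E)
    (u : nat -> nat -> E -> E) (p : nat -> nat -> E -> R) : Prop :=
  (forall i, is_side i -> has_traces Omega i (u i 0%N) (p i 0%N)) /\
  (forall x, interface Omega x ->
    tangential_part 1 (u 1%N 0%N x) = tangential_part 2 (u 2%N 0%N x) /\
    sigma_n nu 1 (u 1%N 0%N) (p 1%N 0%N) x =
      - sigma_n nu 2 (u 2%N 0%N) (p 2%N 0%N) x).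

Definition correction_step (nu : R) (Omega : set E) (k : nat)
    (u : nat -> nat -> E -> E) (p : nat -> nat -> E -> R)
    (w : nat -> nat -> E -> E) (q : nat -> nat -> E -> R) : Prop :=
  forall i, is_side i ->
    correction_problem nu Omega i
      (fun x => ((-1) ^+ i * 2^-1) *:
         (normal_part 1 (u 1%N k x) - normal_part 2 (u 2%N k x)))
      (fun x => - (2^-1 *: (sigma_tau nu 1 (u 1%N k) (p 1%N k) x +
                            sigma_tau nu 2 (u 2%N k) (p 2%N k) x)))
      (w i k.+1) (q i k.+1).

Definition update_step (nu : R) (Omega : set E) (f : E -> E) (k : nat)
    (u : nat -> nat -> E -> E) (p : nat -> nat -> E -> R)
    (w : nat -> nat -> E -> E) (q : nat -> nat -> E -> R) : Prop :=
  forall i, is_side i ->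
    update_problem nu Omega i f
      (fun x => tangential_part i (u i k x) +
         2^-1 *: (tangential_part 1 (w 1%N k.+1 x) +
                  tangential_part 2 (w 2%N k.+1 x)))
      (fun x => sigma_n nu i (u i k) (p i k) x +
         ((-1) ^+ i.-1 * 2^-1) *:
           (sigma_n nu 1 (w 1%N k.+1) (q 1%N k.+1) x -
            sigma_n nu 2 (w 2%N k.+1) (q 2%N k.+1) x))
      (u i k.+1) (p i k.+1).

End Stokes.

(* Main.v *)
Require Import Defs.
From HB Require Import structures.
From mathcomp Require Import all_boot all_order all_algebra.
From mathcomp Require Import all_classical all_reals all_analysis.
From mathcomp Require Import ring lra.


Import Order.TTheory GRing.Theory Num.Theory.
Import numFieldNormedType.Exports.

Set Implicit Arguments.
Unset Strict Implicit.
Unset Printing Implicit Defensive.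

Local Open Scope classical_set_scope.
Local Open Scope ring_scope.

(** Reflecting the correction on the opposite half-domain gives a field with the
    same tangential trace on the interface and the opposite outward normal
    traction.  Hence [u_i^1 + (w_i^2 + mirror w_j^2) / 2], [j] the other side,
    solves the same update problem as [u_i^2] and is equal to it by uniqueness.
    Inserting the data of the correction step, the two fields [u_i^2] and their
    tangential [x]-derivatives coincide on the interface, and so do the normal
    tractions, since every update preserves their equality.  The divergence
    constraint then matches all first derivatives, and the traction the
    pressures.  Schwarz's theorem matches the mixed second derivatives; the
    remaining ones and the gradient of the pressure follow from the momentum
    equation and from the normal derivative of the divergence constraint.  So
    the two halves glue to a [C^2] solution of the Stokes problem. *)

(** * Pointwise limits and directional derivatives *)

Section Derivatives.
Context {R : realType} {V W : normedModType R}.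
Implicit Types (f g : V -> W) (x v : V) (D : set V).

(** Limits along the neighbourhoods of [x] within [D] are unique, that filter being proper when [x]
    is adherent to [D]. This carries every identity from an open half of the domain to the
    interface. *)
Lemma eq_at_closure f g D x :
  {for x, continuous f} -> {for x, continuous g} -> closure D x ->
  (forall y, D y -> f y = g y) -> f x = g x.
Proof.
move=> cf cg Dx fg.
have PF : ProperFilter (within D (nbhs x)) by apply: within_nbhs_proper.
have fx : f @ within D (nbhs x) --> f x by apply: cvg_within_filter; exact: cf.
have gx : g @ within D (nbhs x) --> g x by apply: cvg_within_filter; exact: cg.
apply: (@cvg_unique _ (@norm_hausdorff _ W) _ _ _ _ fx).
apply: cvg_trans gx; apply: near_eq_cvg.
by rewrite near_withinE; apply: nearW => y /fg.
Qed.

Lemma near_eq_on f g D x : open D -> D x ->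
  (forall y, D y -> f y = g y) -> \forall y \near x, f y = g y.
Proof. by move=> oD Dx fg; apply: filterS fg _; exact: open_nbhs_nbhs. Qed.

Lemma derive_eq_on f g D x v : open D -> D x ->
  (forall y, D y -> f y = g y) -> 'D_v f x = 'D_v g x.
Proof. by move=> oD Dx fg; apply: near_eq_derive; exact: near_eq_on oD Dx fg. Qed.

Lemma derivable_eq_on f g D x v : open D -> D x ->
  (forall y, D y -> f y = g y) -> derivable f x v -> derivable g x v.
Proof.
by move=> oD Dx fg; apply: near_eq_derivable; exact: near_eq_on oD Dx fg.
Qed.

Lemma continuous_eq_on f g D x : open D -> D x ->
  (forall y, D y -> f y = g y) -> {for x, continuous f} ->
  {for x, continuous g}.
Proof.
move=> oD Dx fg cf; rewrite /prop_for /continuous_at -(fg _ Dx).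
by apply: (cvg_trans _ cf); apply: near_eq_cvg; exact: near_eq_on oD Dx fg.
Qed.

Lemma dnbhs0N : (fun h : R => - h) @ 0^' --> 0^'.
Proof.
move=> A /= /nbhs_ballP[e /= e0 eA]; apply/nbhs_ballP; exists e => //= h he h0.
by apply: eA; [move: he; rewrite /ball /= !sub0r !normrN|rewrite oppr_eq0].
Qed.

(** Substitute [- h] for [h] in the difference quotient. Derivability in one direction alone says
    nothing of linearity in the direction. *)
Lemma is_derive_opp_direction f x v :
  derivable f x v -> is_derive x (- v) f (- 'D_v f x).
Proof.
move=> /[dup] df /cvg_ex[l fl].
have fN : (fun h => h^-1 *: ((f \o shift x) (h *: - v) - f x)) @ 0^' --> - l.
  apply: (cvg_trans _ (cvgN (cvg_comp _ _ dnbhs0N fl))).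
  apply: near_eq_cvg; near=> h.
  by rewrite /= fctE /= invrN scaleNr opprK scaleNr scalerN.
have [dN dNE] := (cvgP _ fN, cvg_lim (@norm_hausdorff _ W) fN).
by split=> //; rewrite [LHS]dNE /derive (cvg_lim (@norm_hausdorff _ W) fl).
Unshelve. all: by end_near. Qed.

End Derivatives.

(** * Schwarz's theorem for scalar functions *)

Section Schwarz.
Context {R : realType} {V : normedModType R}.
Implicit Types (f : V -> R) (x a b : V).

Lemma is_derive_line f x a (s : R) : derivable f (s *: a + x) a ->
  is_derive s 1 (fun r : R => f (r *: a + x)) ('D_a f (s *: a + x)).
Proof.
have eq : (fun h : R => h^-1 *: ((f \o shift (s *: a + x)) (h *: a) -
    f (s *: a + x))) = (fun h : R => h^-1 *: (((fun r : R => f (r *: a + x))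
    \o shift s) (h *: 1) - f (s *: a + x))).
  apply/funext => h /=; congr (_ *: (f _ - _)).
  by rewrite scalerDl addrA [h *: 1]mulr1.
by move=> df; split; rewrite /derivable /derive -eq.
Qed.

(** The mean value theorem is used twice: along [a] for the difference [phi] of [f] on two parallel
    segments, then along [b] for ['D_a f] at the abscissa [s] so obtained. *)
Lemma second_difference f x a b (h : R) : 0 <= h ->
  (forall s t, 0 <= s <= h -> 0 <= t <= h ->
    derivable f (s *: a + (t *: b + x)) a /\
    derivable ('D_a f) (s *: a + (t *: b + x)) b) ->
  exists s t, [/\ 0 <= s <= h, 0 <= t <= h &
    f (h *: a + (h *: b + x)) - f (h *: a + x) - f (h *: b + x) + f x =
    h * h * 'D_b ('D_a f) (s *: a + (t *: b + x))].
Proof.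
move=> h0 df.
have h0h : 0 <= h <= h by rewrite h0 lexx.
have h00 : 0 <= (0 : R) <= h by rewrite lexx.
pose phi (s : R) := f (s *: a + (h *: b + x)) - f (s *: a + x).
pose dphi (s : R) := 'D_a f (s *: a + (h *: b + x)) - 'D_a f (s *: a + x).
have isphi (s : R) : 0 <= s <= h -> is_derive s 1 phi (dphi s).
  move=> sh; apply: is_deriveB; apply: is_derive_line.
    by have [] := df _ _ sh h0h.
  by have [] := df _ _ sh h00; rewrite scale0r add0r.
have [||s] := @MVT_segment _ phi dphi 0 h h0.
- by move=> s; rewrite in_itv /= => /andP[s0 sh]; apply: isphi; rewrite !ltW.
- apply: derivable_within_continuous => s; rewrite in_itv /= => sh.
  by have [] := isphi _ sh.
rewrite in_itv /= subr0 => sh phiE.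
pose psi (t : R) := 'D_a f (t *: b + (s *: a + x)).
pose dpsi (t : R) := 'D_b ('D_a f) (t *: b + (s *: a + x)).
have ispsi (t : R) : 0 <= t <= h -> is_derive t 1 psi (dpsi t).
  by move=> th; apply: is_derive_line; have [_] := df _ _ sh th; rewrite addrCA.
have [||t] := @MVT_segment _ psi dpsi 0 h h0.
- by move=> t; rewrite in_itv /= => /andP[t0 th]; apply: ispsi; rewrite !ltW.
- apply: derivable_within_continuous => t; rewrite in_itv /= => th.
  by have [] := ispsi _ th.
rewrite in_itv /= subr0 => th psiE.
exists s, t; split=> //.
have -> : s *: a + (t *: b + x) = t *: b + (s *: a + x) by rewrite addrCA.
rewrite -/(dpsi t) -mulrA [h * dpsi t]mulrC -psiE.
rewrite /psi scale0r add0r [h *: b + (_ + _)]addrCA -/(dphi s) mulrC -phiE /phi.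
rewrite scale0r !add0r; ring.
Qed.

(** The second difference is symmetric in [a] and [b], so the two mixed derivatives take a common
    value at two points close to [x]; by continuity each is within [e / 2] of its value at [x]. *)
Lemma derive_symmetric f x a b :
  (\forall y \near x, [/\ derivable f y a, derivable f y b,
     derivable ('D_a f) y b & derivable ('D_b f) y a]) ->
  {for x, continuous ('D_b ('D_a f))} -> {for x, continuous ('D_a ('D_b f))} ->
  'D_b ('D_a f) x = 'D_a ('D_b f) x.
Proof.
move=> df cba cab; apply/eqP; rewrite -subr_eq0 -normr_le0.
apply/ler_addgt0Pl => e e0; rewrite addr0.
have e20 : 0 < e / 2 by rewrite divr_gt0.
move/cvgrPdist_le : cba => /(_ _ e20) cba.
move/cvgrPdist_le : cab => /(_ _ e20) cab.
have fnear : \forall y \near x, [/\ derivable f y a, derivable f y b,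
     derivable ('D_a f) y b & derivable ('D_b f) y a] /\
    (`|'D_b ('D_a f) x - 'D_b ('D_a f) y| <= e / 2 /\
     `|'D_a ('D_b f) x - 'D_a ('D_b f) y| <= e / 2).
  exact: (filterI df (filterI cba cab)).
have [r /= r0 rP] := (@nbhs_ballP R V x _).1 fnear.
(* The parallelogram with sides [h *: a] and [h *: b] at [x] has to stay in the ball of radius [r];
   the summand [1] keeps the denominator positive when [a] and [b] vanish. *)
pose h := r / (1 + `|a| + `|b|) / 2.
have ab0 : 0 < 1 + `|a| + `|b| by rewrite -addrA ltr_pwDl // addr_ge0.
have h0 : 0 < h by rewrite !divr_gt0.
have hP s t : 0 <= s <= h -> 0 <= t <= h -> ball x r (s *: a + (t *: b + x)).
  move=> /andP[s0 sh] /andP[t0 th].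
  rewrite -ball_normE /= distrC addrA addrK.
  apply: le_lt_trans (ler_normD _ _) _; rewrite !normrZ !ger0_norm //.
  apply: le_lt_trans (_ : h * `|a| + h * `|b| < _).
    by rewrite lerD // ler_wpM2r.
  have -> : r = h * 2 * (1 + `|a| + `|b|).
    by rewrite /h; field; rewrite gt_eqF.
  rewrite -mulrDr -mulrA ltr_pM2l //.
  have := normr_ge0 a; have := normr_ge0 b; lra.
have [s [t [sh th E1]]] : exists s t, [/\ 0 <= s <= h, 0 <= t <= h &
    f (h *: a + (h *: b + x)) - f (h *: a + x) - f (h *: b + x) + f x =
    h * h * 'D_b ('D_a f) (s *: a + (t *: b + x))].
  apply: second_difference => [|s t sh th]; first exact: ltW.
  have [[dfa _ dab _] _] := rP _ (hP _ _ sh th).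
  by split; [exact: dfa|exact: dab].
have [t' [s' [th' sh' E2]]] : exists t s, [/\ 0 <= t <= h, 0 <= s <= h &
    f (h *: b + (h *: a + x)) - f (h *: b + x) - f (h *: a + x) + f x =
    h * h * 'D_a ('D_b f) (t *: b + (s *: a + x))].
  apply: second_difference => [|t' s' th' sh']; first exact: ltW.
  rewrite (addrCA (t' *: b)); have [[_ dfb _ dba] _] := rP _ (hP _ _ sh' th').
  by split; [exact: dfb|exact: dba].
have [_ [/= B1 _]] := rP _ (hP _ _ sh th).
have [_ [_ /= B2]] := rP _ (hP _ _ sh' th').
(* [E1] and [E2] evaluate the same second difference; divide by [h * h]. *)
have EE : 'D_b ('D_a f) (s *: a + (t *: b + x)) =
          'D_a ('D_b f) (s' *: a + (t' *: b + x)).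
  have hh : h * h != 0 by rewrite mulf_neq0 // gt_eqF.
  rewrite (addrCA (s' *: a)) (addrCA (h *: b) (h *: a)) in E2 *.
  by apply: (mulfI hh); apply: (etrans (esym E1)); rewrite -E2; ring.
rewrite EE in B1; rewrite distrC in B2; rewrite (splitr e).
exact: le_trans (ler_distD _ _ _) (lerD B1 B2).
Qed.

End Schwarz.

(** * Functions of class [C^k] and their gluing along the hyperplane *)

Section Regularity.
Context {R : realType} {d : nat} {W : normedModType R}.
Notation E := 'rV[R]_d.+1.
Implicit Types (f g : E -> W) (x v : E) (A B D O : set E) (k : nat).

Lemma Ck_continuous k A f x : Ck k A f -> A x -> {for x, continuous f}.
Proof. by case: k => [|k] [cf _] /cf. Qed.

Lemma Ck_derivable k A f j x :
  Ck k.+1 A f -> A x -> derivable f x (basis_vec R j).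
Proof. by move=> [_ /(_ j)[df _]] /df. Qed.

Lemma Ck_derive k A f j : Ck k.+1 A f -> Ck k A ('D_(basis_vec R j) f).
Proof. by move=> [_ /(_ j)[]]. Qed.

Lemma Ck_sub k A B f : A `<=` B -> Ck k B f -> Ck k A f.
Proof.
move=> AB; elim: k f => [|k IH] f [cf df]; split=> //.
- by move=> x /AB; exact: cf.
- by move=> x /AB; exact: cf.
- by move=> j; have [dfj /IH] := df j; split=> // x /AB; exact: dfj.
Qed.

Lemma Ck_eq_on k A f g : open A -> (forall x, A x -> f x = g x) ->
  Ck k A f -> Ck k A g.
Proof.
move=> oA; elim: k f g => [|k IH] f g fg [cf df]; split=> //.
- by move=> x Ax; apply: (continuous_eq_on oA Ax fg); exact: cf.
- by move=> x Ax; apply: (continuous_eq_on oA Ax fg); exact: cf.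
- move=> j; have [dfj Cfj] := df j; split.
    by move=> x Ax; apply: (derivable_eq_on oA Ax fg); exact: dfj.
  by apply: IH Cfj => x Ax; exact: derive_eq_on fg.
Qed.

(** Points of the hyperplane itself take the value of the second function. *)
Definition glue (T : Type) (f g : E -> T) : E -> T :=
  fun x => if x 0 ord0 < 0 then f x else g x.

Lemma continuous_coord0 : continuous (fun x : E => x 0 ord0).
Proof. exact: coord_continuous. Qed.

Lemma open_left : open [set x : E | x 0 ord0 < 0].
Proof.
apply: (@open_comp _ _ (fun x : E => x 0 ord0) [set t | t < 0]).
  by move=> x _; exact: continuous_coord0.
exact: open_lt.
Qed.

Lemma open_right : open [set x : E | 0 < x 0 ord0].
Proof.
apply: (@open_comp _ _ (fun x : E => x 0 ord0) [set t | 0 < t]).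
  by move=> x _; exact: continuous_coord0.
exact: open_gt.
Qed.

(** Both branches have the same limit, so [b] may switch between them arbitrarily along the
    filter. *)
Lemma cvg_if (T : Type) (F : set_system T) (b : T -> bool) (f g : T -> W) (l : W) :
  Filter F -> f @ F --> l -> g @ F --> l ->
  (fun t => if b t then f t else g t) @ F --> l.
Proof.
move=> FF fl gl A Al.
have fA : F (f @^-1` A) := fl A Al.
have gA : F (g @^-1` A) := gl A Al.
change (F ((fun t => if b t then f t else g t) @^-1` A)).
by apply: filterS2 fA gA => t fA gA /=; case: (b t).
Qed.

Lemma glue_left (T : Type) (f g : E -> T) x : x 0 ord0 < 0 -> glue f g x = f x.
Proof. by rewrite /glue => ->. Qed.

Lemma glue_right (T : Type) (f g : E -> T) x :
  0 <= x 0 ord0 -> glue f g x = g x.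
Proof. by rewrite /glue ltNge => ->. Qed.

Lemma continuous_glue f g x :
  (x 0 ord0 <= 0 -> {for x, continuous f}) ->
  (0 <= x 0 ord0 -> {for x, continuous g}) ->
  (hyperplane x -> f x = g x) -> {for x, continuous (glue f g)}.
Proof.
move=> cf cg fg; have [x0|x0|x0] := ltgtP (x 0 ord0) 0.
- apply: (continuous_eq_on open_left x0) (cf (ltW x0)).
  by move=> y y0; rewrite glue_left.
- apply: (continuous_eq_on open_right x0) (cg (ltW x0)).
  by move=> y /ltW y0; rewrite glue_right.
have {}cf : f @ x --> f x by apply: cf; rewrite x0.
have {}cg : g @ x --> g x by apply: cg; rewrite x0.
have gx : glue f g x = g x by rewrite glue_right // x0.
rewrite /prop_for /continuous_at gx; apply: (@cvg_if _ (nbhs x)) => //.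
by rewrite -(fg x0).
Qed.

(** Off the hyperplane the glued function is locally [f] or [g]. On it, each difference quotient is
    one of [f] or of [g] at a common base value, and both have the same limit. *)
Lemma is_derive_glue f g x v :
  (x 0 ord0 <= 0 -> derivable f x v) -> (0 <= x 0 ord0 -> derivable g x v) ->
  (hyperplane x -> f x = g x /\ 'D_v f x = 'D_v g x) ->
  is_derive x v (glue f g) (glue ('D_v f) ('D_v g) x).
Proof.
move=> df dg fg; have [x0|x0|x0] := ltgtP (x 0 ord0) 0.
- rewrite glue_left //.
  have gE (y : E) : y 0 ord0 < 0 -> f y = glue f g y by move=> y0; rewrite glue_left.
  split; first exact: (derivable_eq_on open_left x0 gE (df (ltW x0))).
  by rewrite (derive_eq_on v open_left x0 gE).
- rewrite glue_right ?ltW //.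
  have gE (y : E) : 0 < y 0 ord0 -> g y = glue f g y.
    by move=> /ltW y0; rewrite glue_right.
  split; first exact: (derivable_eq_on open_right x0 gE (dg (ltW x0))).
  by rewrite (derive_eq_on v open_right x0 gE).
have [fgx Dfg] := fg x0.
have {}df : derivable f x v by apply: df; rewrite x0.
have {}dg : derivable g x v by apply: dg; rewrite x0.
have gx : glue f g x = g x by rewrite glue_right // x0.
have L : (fun h => h^-1 *: ((glue f g \o shift x) (h *: v) - glue f g x)) @ 0^'
    --> 'D_v g x.
  pose b (h : R) := (h *: v + x) 0 ord0 < 0.
  rewrite (_ : (fun h : R => _) = fun h => if b h
      then h^-1 *: ((f \o shift x) (h *: v) - f x)
      else h^-1 *: ((g \o shift x) (h *: v) - g x)); last first.
    by apply/funext => h; rewrite gx /b /= /glue; case: ifP; rewrite ?fgx.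
  by apply: cvg_if => //; rewrite -Dfg.
split; first exact: cvgP L.
by rewrite glue_right ?x0 //; exact: (cvg_lim (@norm_hausdorff _ W) L).
Qed.

(** Equality of jets of order [k] along [D]. It is meant for pieces of the hyperplane, where equal
    values do not force equal normal derivatives. *)
Fixpoint agree k D f g : Prop :=
  (forall x, D x -> f x = g x) /\
  match k with
  | 0%N => True
  | k'.+1 => forall j,
      agree k' D ('D_(basis_vec R j) f) ('D_(basis_vec R j) g)
  end.

Lemma agree_eq k D f g x : agree k D f g -> D x -> f x = g x.
Proof. by case: k => [|k] [fg _] /fg. Qed.

Lemma derive_glue k O A B f g j x :
  (forall x, O x -> x 0 ord0 <= 0 -> A x) ->
  (forall x, O x -> 0 <= x 0 ord0 -> B x) ->
  Ck k.+1 A f -> Ck k.+1 B g -> agree k.+1 (O `&` @hyperplane R d) f g -> O x ->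
  is_derive x (basis_vec R j) (glue f g)
    (glue ('D_(basis_vec R j) f) ('D_(basis_vec R j) g) x).
Proof.
move=> OA OB Cf Cg fg Ox; apply: is_derive_glue.
- by move=> x0; exact: Ck_derivable Cf (OA _ Ox x0).
- by move=> x0; exact: Ck_derivable Cg (OB _ Ox x0).
- by move=> hx; split; [exact: agree_eq fg _|
    apply: agree_eq (proj2 fg j) _].
Qed.

(** Induction on [k]: on [O] a partial derivative of the glued function is the glued partial
    derivative, to which the induction hypothesis applies. [A] and [B] contain the closed halves of
    [O], so both functions are regular at the hyperplane. *)
Lemma Ck_glue k O A B f g : open O ->
  (forall x, O x -> x 0 ord0 <= 0 -> A x) ->
  (forall x, O x -> 0 <= x 0 ord0 -> B x) ->
  Ck k A f -> Ck k B g -> agree k (O `&` @hyperplane R d) f g ->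
  Ck k O (glue f g).
Proof.
move=> oO OA OB; elim: k f g => [|k IH] f g Cf Cg fg; split=> //.
- move=> x Ox; apply: continuous_glue => [x0|x0|x0].
  + exact: Ck_continuous Cf (OA _ Ox x0).
  + exact: Ck_continuous Cg (OB _ Ox x0).
  + exact: agree_eq fg _.
- move=> x Ox; apply: continuous_glue => [x0|x0|x0].
  + exact: Ck_continuous Cf (OA _ Ox x0).
  + exact: Ck_continuous Cg (OB _ Ox x0).
  + exact: agree_eq fg _.
- move=> j; split.
    by move=> x Ox; have [] := derive_glue j OA OB Cf Cg fg Ox.
  apply: (@Ck_eq_on _ _ (glue ('D_(basis_vec R j) f) ('D_(basis_vec R j) g))) => //.
    by move=> x Ox; have [_ ->] := derive_glue j OA OB Cf Cg fg Ox.
  by apply: IH; [exact: Ck_derive|exact: Ck_derive|exact: (proj2 fg j)].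
Qed.

(** For [j != ord0] the line through [x] along the basis vector stays in the hyperplane, so the
    difference quotients coincide for small steps. *)
Lemma derive_tangential O f g j x : open O -> j != ord0 ->
  (forall y, O y -> hyperplane y -> f y = g y) -> O x -> hyperplane x ->
  'D_(basis_vec R j) f x = 'D_(basis_vec R j) g x.
Proof.
move=> oO j0 fg Ox hx; rewrite /derive.
have cv : (fun h : R => h *: basis_vec R j + x) @ (0 : R) --> x.
  have : (fun h : R => h *: basis_vec R j + x) @ (0 : R) -->
      0 *: basis_vec R j + x.
    by apply: cvgD; [apply: cvgZ; [exact: cvg_id|exact: cvg_cst]|exact: cvg_cst].
  by rewrite scale0r add0r.
have E : \forall h \near (0 : R), f (h *: basis_vec R j + x) =
    g (h *: basis_vec R j + x).
  near=> h; apply: fg.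
    by near: h; apply: cv; exact: open_nbhs_nbhs.
  by rewrite /hyperplane /= !mxE eq_sym (negbTE j0) mulr0 add0r.
(* The image filters of the two quotients are equal, hence so are their [lim], even without
   convergence. *)
congr (lim _); rewrite eqEsubset; split; apply/near_eq_cvg/cvg_within;
  by near=> h; rewrite /= (fg x) //; congr (_ *: (_ - _)); near: h;
    apply: filterS E.
Unshelve. all: by end_near. Qed.

End Regularity.

(** * Entries of vector fields, and Schwarz's theorem for vector fields *)

Section Coordinates.
Context {R : realType} {d : nat}.
Notation E := 'rV[R]_d.+1.
Implicit Types (f g : E -> E) (x v : E) (A : set E).

Lemma derive_coord f x v i j : derivable f x v ->
  'D_v f x i j = 'D_v (fun y => f y i j) x.
Proof. by move=> df; rewrite derive_mx // mxE. Qed.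

Lemma continuous_entry f x i c :
  {for x, continuous f} -> {for x, continuous (fun y => f y i c)}.
Proof.
move=> cf; apply: (@continuous_comp _ _ _ f (fun M : E => M i c)) => //.
exact: coord_continuous.
Qed.

Lemma Ck_coord k A f i c : open A -> Ck k A f -> Ck k A (fun x => f x i c).
Proof.
move=> oA; elim: k f => [|k IH] f [cf df]; split=> //.
- by move=> x Ax; apply: continuous_entry; exact: cf.
- by move=> x Ax; apply: continuous_entry; exact: cf.
- move=> j; have [dfj Cfj] := df j; split.
    by move=> x Ax; have /derivable_mxP := dfj x Ax; apply.
  apply: Ck_eq_on (IH _ Cfj) => // x Ax.
  by rewrite derive_coord //; exact: dfj.
Qed.

Lemma Ck_derive_symmetric f A x a b : open A -> A x -> Ck 2 A f ->
  'D_(basis_vec R a) ('D_(basis_vec R b) f) x =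
  'D_(basis_vec R b) ('D_(basis_vec R a) f) x.
Proof.
move=> oA Ax Cf; apply/rowP => c.
have coord2 (i j : 'I_d.+1) :
    ('D_(basis_vec R i) ('D_(basis_vec R j) f) x) 0 c =
    'D_(basis_vec R i) ('D_(basis_vec R j) (fun y => f y 0 c)) x.
  rewrite derive_coord; last exact: Ck_derivable (Ck_derive _ Cf) Ax.
  apply: (derive_eq_on _ oA Ax) => y Ay.
  by rewrite derive_coord //; exact: Ck_derivable Cf Ay.
apply: (etrans (coord2 a b)); apply: (etrans _ (esym (coord2 b a))).
have Cc := @Ck_coord 2 A f 0 c oA Cf.
apply: derive_symmetric.
- apply: filterS (open_nbhs_nbhs (conj oA Ax)) => y Ay.
  split; [exact: Ck_derivable Cc Ay|exact: Ck_derivable Cc Ay| |].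
    exact: Ck_derivable (Ck_derive _ Cc) Ay.
  exact: Ck_derivable (Ck_derive _ Cc) Ay.
- exact: Ck_continuous (Ck_derive _ (Ck_derive _ Cc)) Ax.
- exact: Ck_continuous (Ck_derive _ (Ck_derive _ Cc)) Ax.
Qed.

End Coordinates.

(** * Derivatives of linear combinations and along signed directions *)

Section Combination.
Context {R : realType} {V W : normedModType R}.
Implicit Types (f g : V -> W) (x v : V) (a : R).

Lemma is_derive_combination f g x v a : derivable f x v -> derivable g x v ->
  is_derive x v (fun y => a *: f y + g y) (a *: 'D_v f x + 'D_v g x).
Proof.
move=> df dg; have df' : derivable (fun y => a *: f y) x v by exact: derivableZ.
split; first exact: (derivableD df' dg).
by rewrite (deriveD df' dg) (deriveZ a df).
Qed.

(** The outward normals and the mirrored basis vectors are basis vectors up to such a sign. *)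
Lemma is_derive_sign f x v n : derivable f x v ->
  is_derive x ((-1) ^+ n *: v) f ((-1) ^+ n *: 'D_v f x).
Proof.
move=> df; rewrite -signr_odd; case: (odd n); last first.
  by rewrite !scale1r; split.
by rewrite !scaleN1r; exact: is_derive_opp_direction.
Qed.

End Combination.

(** * Reflection of fields and invariance of the Stokes equations *)

Section Mirror.
Context {R : realType} {d : nat}.
Notation E := 'rV[R]_d.+1.
Notation e_ := (basis_vec R).
Implicit Types (x y v : E) (u : E -> E) (p : E -> R) (D : set E).

Lemma mirrorE x j : mirror x 0 j = (-1) ^+ (j == ord0) * x 0 j.
Proof. by rewrite mxE; case: eqP; rewrite ?mulN1r ?mul1r. Qed.

Lemma mirrorK : involutive (@mirror R d).
Proof. by move=> x; apply/rowP => j; rewrite !mirrorE mulrA -expr2 sqrr_sign mul1r. Qed.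

Lemma mirrorD x y : mirror (x + y) = mirror x + mirror y.
Proof. by apply/rowP => j; rewrite mirrorE [RHS]mxE [in LHS]mxE !mirrorE mulrDr. Qed.

Lemma mirrorZ (a : R) x : mirror (a *: x) = a *: mirror x.
Proof. by apply/rowP => j; rewrite mirrorE [RHS]mxE [in LHS]mxE !mirrorE mulrCA. Qed.

Lemma mirror0 : mirror (0 : E) = 0.
Proof. by rewrite -(scale0r 0) mirrorZ !scale0r. Qed.

Lemma mirrorN x : mirror (- x) = - mirror x.
Proof. by rewrite -scaleN1r mirrorZ scaleN1r. Qed.

Lemma mirror_basis j : mirror (e_ j) = (-1) ^+ (j == ord0) *: (e_ j : E).
Proof.
apply/rowP => k; rewrite mirrorE [RHS]mxE !mxE /=.
by have [->|] := eqVneq k j; rewrite ?mulr0.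
Qed.

Lemma mirror_hyperplane x : hyperplane x -> mirror x = x.
Proof.
move=> x0; apply/rowP => j; rewrite mirrorE.
by have [->|] := eqVneq j ord0; rewrite ?mul1r // x0 mulr0.
Qed.

Lemma ball_mirror x y (r : R) : ball x r y -> ball (mirror x) r (mirror y).
Proof.
move=> [r0 xy]; split=> // i j; have := xy i j; rewrite -!ball_normE /= ord1 !mirrorE.
by rewrite -mulrBr normrM normrX normrN1 expr1n mul1r.
Qed.

Lemma continuous_mirror : continuous (@mirror R d).
Proof.
move=> x A /nbhs_ballP[r /= r0 rA]; apply/nbhs_ballP; exists r => //= y xy.
by apply: rA; exact: ball_mirror.
Qed.

Lemma open_mirror D : open D -> open (@mirror R d @^-1` D).
Proof. by apply: open_comp => x _; exact: continuous_mirror. Qed.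

Lemma closure_mirror D x :
  closure (@mirror R d @^-1` D) x -> closure D (mirror x).
Proof.
by move=> cDx B /continuous_mirror /cDx[y [Dy By]]; exists (mirror y).
Qed.

Lemma interior_mirror D x :
  interior D (mirror x) -> interior (@mirror R d @^-1` D) x.
Proof. by move=> /continuous_mirror. Qed.

Lemma boundary_mirror D x :
  boundary (@mirror R d @^-1` D) x -> boundary D (mirror x).
Proof.
by move=> [cx ix]; split; [exact: closure_mirror|move=> /interior_mirror].
Qed.

(** By linearity of [mirror], the quotient of the mirrored field is the mirror of a quotient of [u]
    along [mirror v]; continuity of [mirror] then passes to the limit. *)
Lemma is_derive_mirror_velocity u x v : derivable u (mirror x) (mirror v) ->
  is_derive x v (mirror_velocity u) (mirror ('D_(mirror v) u (mirror x))).
Proof.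
move=> /cvg_ex[l ul].
have L : (fun h => h^-1 *: ((mirror_velocity u \o shift x) (h *: v) -
    mirror_velocity u x)) @ 0^' --> mirror l.
  rewrite (_ : (fun h : R => _) = @mirror R d \o (fun h : R =>
      h^-1 *: ((u \o shift (mirror x)) (h *: mirror v) - u (mirror x)))).
    apply: (cvg_comp _ _ ul); exact: continuous_mirror.
  apply/funext => h /=.
  by rewrite /mirror_velocity mirrorD mirrorZ mirrorZ mirrorD mirrorN.
split; first exact: cvgP L.
rewrite /derive (cvg_lim (@norm_hausdorff _ E) ul).
exact: (cvg_lim (@norm_hausdorff _ E) L).
Qed.

Lemma is_derive_mirror_pressure p x v : derivable p (mirror x) (mirror v) ->
  is_derive x v (mirror_pressure p) ('D_(mirror v) p (mirror x)).
Proof.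
have eq : (fun h : R => h^-1 *: ((mirror_pressure p \o shift x) (h *: v) -
    mirror_pressure p x)) = (fun h : R =>
      h^-1 *: ((p \o shift (mirror x)) (h *: mirror v) - p (mirror x))).
  by apply/funext => h /=; rewrite /mirror_pressure mirrorD mirrorZ.
by move=> df; split; rewrite /derivable /derive eq.
Qed.

Lemma is_derive_mirror_velocity_basis u x j :
  derivable u (mirror x) (e_ j) ->
  is_derive x (e_ j) (mirror_velocity u)
    ((-1) ^+ (j == ord0) *: mirror_velocity ('D_(e_ j) u) x).
Proof.
move=> du; have [du' eq] := is_derive_sign (j == ord0) du.
rewrite -mirror_basis in du' eq.
have [dm meq] := is_derive_mirror_velocity du'.
by split=> //; rewrite meq eq mirrorZ.
Qed.

Lemma is_derive_mirror_pressure_basis p x j :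
  derivable p (mirror x) (e_ j) ->
  is_derive x (e_ j) (mirror_pressure p)
    ((-1) ^+ (j == ord0) * 'D_(e_ j) p (mirror x)).
Proof.
move=> du; have [du' eq] := is_derive_sign (j == ord0) du.
rewrite -mirror_basis in du' eq.
have [dm meq] := is_derive_mirror_pressure du'.
by split=> //; rewrite meq eq.
Qed.

(** Each direction is differentiated twice, so its sign is squared. *)
Lemma laplacian_mirror u D x : open D -> Ck 2 D u -> D (mirror x) ->
  laplacian (mirror_velocity u) x = mirror (laplacian u (mirror x)).
Proof.
move=> oD Cu Dx; rewrite /laplacian (big_morph _ mirrorD mirror0).
apply: eq_bigr => j _.
have du1 y : D (mirror y) -> derivable u (mirror y) (e_ j).
  by move=> Dy; exact: Ck_derivable Cu Dy.
have du2 : derivable ('D_(e_ j) u) (mirror x) (e_ j).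
  exact: Ck_derivable (Ck_derive _ Cu) Dx.
have [dm dmE] := is_derive_mirror_velocity_basis du2.
rewrite (derive_eq_on _ (open_mirror oD) Dx (g := fun y =>
  (-1) ^+ (j == ord0) *: mirror_velocity ('D_(e_ j) u) y)); last first.
  by move=> y Dy; have [_ eq] := is_derive_mirror_velocity_basis (du1 y Dy).
apply: (etrans (deriveZ _ dm)); rewrite dmE scalerA -expr2 sqrr_sign scale1r.
by [].
Qed.

Lemma gradient_mirror p D x : Ck 1 D p -> D (mirror x) ->
  gradient (mirror_pressure p) x = mirror (gradient p (mirror x)).
Proof.
move=> Cp Dx; apply/rowP => j; rewrite mirrorE !mxE.
have dp : derivable p (mirror x) (e_ j) by exact: Ck_derivable Cp Dx.
by have [_ ->] := is_derive_mirror_pressure_basis dp.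
Qed.

(** In the normal direction, the sign of the derivative cancels the sign of the component. *)
Lemma divergence_mirror u k D x : Ck k.+1 D u -> D (mirror x) ->
  divergence (mirror_velocity u) x = divergence u (mirror x).
Proof.
move=> Cu Dx; apply: eq_bigr => j _.
have du : derivable u (mirror x) (e_ j) by exact: Ck_derivable Cu Dx.
have [_ ->] := is_derive_mirror_velocity_basis du.
by rewrite mxE /mirror_velocity mirrorE mulrA -expr2 sqrr_sign mul1r.
Qed.

Lemma stokes_mirror (nu : R) D (f : E -> E) u p :
  open D -> Ck 2 D u -> Ck 1 D p -> stokes_equations nu D f u p ->
  stokes_equations nu (@mirror R d @^-1` D)
    (mirror_velocity f) (mirror_velocity u) (mirror_pressure p).
Proof.
move=> oD Cu Cp S x Dx; have [S1 S2] := S _ Dx.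
rewrite (laplacian_mirror oD Cu Dx) (gradient_mirror Cp Dx).
rewrite (divergence_mirror Cu Dx); split=> //.
by rewrite -mirrorZ -!mirrorN -mirrorD S1.
Qed.

(** Linearity, in the shape under which the spaces [V i] are closed. *)
Lemma stokes_combination (nu a : R) D (f g u w : E -> E) (p q : E -> R) :
  open D -> Ck 2 D u -> Ck 2 D w -> Ck 1 D p -> Ck 1 D q ->
  stokes_equations nu D g w q -> stokes_equations nu D f u p ->
  stokes_equations nu D (fun x => a *: g x + f x)
    (fun x => a *: w x + u x) (fun x => a * q x + p x).
Proof.
move=> oD Cu Cw Cp Cq Sw Su x Dx; have [Sw1 Sw2] := Sw _ Dx.
have [Su1 Su2] := Su _ Dx.
have D1 j y : D y -> 'D_(e_ j) (fun z => a *: w z + u z) y =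
    a *: 'D_(e_ j) w y + 'D_(e_ j) u y.
  move=> Dy; have dw : derivable w y (e_ j) by exact: Ck_derivable Cw Dy.
  have du : derivable u y (e_ j) by exact: Ck_derivable Cu Dy.
  by have [_ ->] := is_derive_combination a dw du.
have -> : laplacian (fun x => a *: w x + u x) x =
    a *: laplacian w x + laplacian u x.
  rewrite /laplacian scaler_sumr -big_split /=; apply: eq_bigr => j _.
  rewrite (derive_eq_on _ oD Dx (D1 j)).
  have dw : derivable ('D_(e_ j) w) x (e_ j).
    exact: Ck_derivable (Ck_derive _ Cw) Dx.
  have du : derivable ('D_(e_ j) u) x (e_ j).
    exact: Ck_derivable (Ck_derive _ Cu) Dx.
  by have [_ ->] := is_derive_combination a dw du.
have -> : gradient (fun x => a * q x + p x) x = a *: gradient q x + gradient p x.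
  apply/rowP => j; rewrite !mxE.
  have dq : derivable q x (e_ j) by exact: Ck_derivable Cq Dx.
  have dp : derivable p x (e_ j) by exact: Ck_derivable Cp Dx.
  by have [_] := is_derive_combination a dq dp.
have -> : divergence (fun x => a *: w x + u x) x =
    a * divergence w x + divergence u x.
  rewrite /divergence mulr_sumr -big_split /=; apply: eq_bigr => j _.
  by rewrite (D1 _ _ Dx) !mxE.
rewrite Sw2 Su2 mulr0 addr0; split=> //.
rewrite -Sw1 -Su1; move: (laplacian u x) (laplacian w x) => lu lw.
move: (gradient p x) (gradient q x) => gp gq.
by apply/rowP => j; rewrite !mxE; ring.
Qed.

End Mirror.

(** * Normal and tangential traces and stresses in coordinates *)

Section Traces.
Context {R : realType} {d : nat}.
Notation E := 'rV[R]_d.+1.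
Notation e0 := (basis_vec R (ord0 : 'I_d.+1)).
Implicit Types (x a : E) (u : E -> E) (p : E -> R) (i : nat) (j : 'I_d.+1).

(** The sign of the normal occurs twice and cancels, so the parts do not depend on the side. *)
Lemma normal_partE i a : normal_part i a = a 0 ord0 *: e0.
Proof.
rewrite /normal_part /normal.
have -> : dotv a ((-1) ^+ i.-1 *: e0) = (-1) ^+ i.-1 * a 0 ord0.
  rewrite /dotv (bigD1 ord0) //= big1 => [|k k0].
    by rewrite !mxE /= mulr1 addr0 mulrC.
  by rewrite !mxE (negbTE k0) andbF !mulr0.
by rewrite scalerA mulrAC -expr2 sqrr_sign mul1r.
Qed.

Lemma tangential_part0 i a : tangential_part i a 0 ord0 = 0.
Proof. by rewrite /tangential_part normal_partE !mxE /= mulr1 subrr. Qed.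

Lemma tangential_part_coord i a j : j != ord0 -> tangential_part i a 0 j = a 0 j.
Proof.
move=> j0; rewrite /tangential_part normal_partE !mxE.
by rewrite (negbTE j0) andbF mulr0 subr0.
Qed.

Lemma stressE (nu : R) i u p x : derivable u x e0 ->
  stress nu i u p x = (-1) ^+ i.-1 *: (nu *: 'D_e0 u x + p x *: e0).
Proof.
move=> du; rewrite /stress /normal; have [_ ->] := is_derive_sign i.-1 du.
by rewrite scalerDr !scalerA mulrC [p x * _]mulrC.
Qed.

(** The normal stress measured with the fixed normal [e0], so that both sides can be compared
    without signs. *)
Definition normal_traction (nu : R) u p x : R := nu * ('D_e0 u x) 0 ord0 + p x.

Lemma sigma_nE (nu : R) i u p x : derivable u x e0 ->
  sigma_n nu i u p x = ((-1) ^+ i.-1 * normal_traction nu u p x) *: e0.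
Proof.
move=> du; rewrite /sigma_n normal_partE stressE //; congr (_ *: _).
by rewrite !mxE /= mulr1.
Qed.

(** The pressure acts along [e0] only and drops out. *)
Lemma sigma_tau_coord (nu : R) i u p x j : derivable u x e0 -> j != ord0 ->
  sigma_tau nu i u p x 0 j = (-1) ^+ i.-1 * (nu * ('D_e0 u x) 0 j).
Proof.
move=> du j0; rewrite /sigma_tau tangential_part_coord // stressE // !mxE.
by rewrite (negbTE j0) andbF mulr0 addr0.
Qed.

End Traces.

(** * The two halves of a symmetric open set *)

Section Domain.
Context {R : realType} {d : nat} (Omega : set 'rV[R]_d.+1).
Hypothesis oOmega : open Omega.
Hypothesis sOmega : forall x, Omega x -> Omega (mirror x).
Notation E := 'rV[R]_d.+1.
Implicit Types (x y : E) (i j : nat).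

Definition opposite i j := (i = 1%N /\ j = 2%N) \/ (i = 2%N /\ j = 1%N).

Lemma open_subdomain i : open (subdomain Omega i).
Proof.
apply: openI => //; case: (i == 1%N); [exact: open_left|exact: open_right].
Qed.

Lemma subdomain_mirror i j x : opposite i j ->
  subdomain Omega i x -> subdomain Omega j (mirror x).
Proof.
rewrite /subdomain => -[[-> ->]|[-> ->]] [Ox /= x0]; split;
  by [exact: sOmega|rewrite /= mirrorE mulN1r ?oppr_gt0 ?oppr_lt0].
Qed.

Lemma preimage_mirror_subdomain i j : opposite i j ->
  @mirror R d @^-1` subdomain Omega j = subdomain Omega i.
Proof.
move=> ij; apply/seteqP; split=> x; last exact: subdomain_mirror.
rewrite -{2}(mirrorK x); apply: subdomain_mirror.
by case: ij => -[-> ->]; [right|left].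
Qed.

(** Near [x] there is a point of [Omega] off the hyperplane. It or its mirror image lies in the
    required half, and the mirror image is as close to [x], which [mirror] fixes. *)
Lemma interface_sub_closure i x : is_side i -> interface Omega x ->
  closure (subdomain Omega i) x.
Proof.
move=> si [cx hx] B /nbhs_ballP[r /= r0 rB].
have [y [Oy xy]] : exists y, [/\ Omega y & ball x r y].
  by have [y [Oy xy]] := cx _ (nbhsx_ballx x _ r0); exists y.
have [z [Oz xz z0]] : exists z, [/\ Omega z, ball x r z & z 0 ord0 != 0].
  have [y0|y0] := eqVneq (y 0 ord0) 0; last by exists y.
  have oU : open (Omega `&` ball x r) by apply: openI => //; exact: ball_open.
  have /nbhs_ballP[s /= s0 sU] := open_nbhs_nbhs (conj oU (conj Oy xy)).
  (* A point of [Omega] on the hyperplane is pushed off it while staying in the open set [Omega] and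
     in the ball around [x]. *)
  exists (y + (s / 2) *: basis_vec R ord0).
  have [|Oz xz] := sU (y + (s / 2) *: basis_vec R ord0).
    split=> // k l; rewrite -!ball_normE /= !mxE opprD addNKr normrN.
    rewrite normrM ger0_norm ?divr_ge0 ?ltW //.
    case: (_ && _); rewrite ?normr1 ?normr0 ?mulr1 ?mulr0 //; lra.
  by split=> //; rewrite !mxE /= mulr1 y0 add0r gt_eqF // divr_gt0.
have mz : ball x r (mirror z) by rewrite -(mirror_hyperplane hx); exact: ball_mirror.
have [z1|z1|z1] := ltgtP (z 0 ord0) 0.
- case: si => ->; first by exists z; split; [split|exact: rB].
  exists (mirror z); split; last exact: rB.
  by split; [exact: sOmega|rewrite /= mirrorE mulN1r oppr_gt0].
- case: si => ->; last by exists z; split; [split|exact: rB].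
  exists (mirror z); split; last exact: rB.
  by split; [exact: sOmega|rewrite /= mirrorE mulN1r oppr_lt0].
- by rewrite z1 eqxx in z0.
Qed.

End Domain.

Lemma row_add {R : realType} {n} (a b : 'rV[R]_n) k : (a + b) 0 k = a 0 k + b 0 k.
Proof. by rewrite mxE. Qed.

Lemma row_opp {R : realType} {n} (a : 'rV[R]_n) k : (- a) 0 k = - a 0 k.
Proof. by rewrite mxE. Qed.

Lemma row_scale {R : realType} {n} (c : R) (a : 'rV[R]_n) k :
  (c *: a) 0 k = c * a 0 k.
Proof. by rewrite mxE. Qed.

(** Unlike [mxE], these rules leave the entries of [mirror] folded for [mirrorE]. *)
Definition entryE := (@row_add, @row_opp, @row_scale).

(** * The update expressed through the reflected correction *)

Section Update.
Context {R : realType} {d : nat}.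
Variables (nu : R) (Omega : set 'rV[R]_d.+1) (f : 'rV[R]_d.+1 -> 'rV[R]_d.+1).
Variable V : nat -> ('rV[R]_d.+1 -> 'rV[R]_d.+1) -> ('rV[R]_d.+1 -> R) -> Prop.
Hypothesis oOmega : open Omega.
Hypothesis sOmega : forall x, Omega x -> Omega (mirror x).
Hypothesis hV : solution_spaces Omega V.
Hypothesis hupdate : update_unique nu Omega f V.
Notation E := 'rV[R]_d.+1.
Notation e0 := (basis_vec R (ord0 : 'I_d.+1)).
Implicit Types (x : E) (u w : E -> E) (p q : E -> R) (i j : nat).

Lemma opposite_side i j : opposite i j -> is_side i /\ is_side j.
Proof. by case=> -[-> ->]; split; [left|right|right|left]. Qed.

Lemma regular_Ck i u p : regular Omega i u p ->
  Ck 2 (subdomain Omega i) u /\ Ck 1 (subdomain Omega i) p.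
Proof.
move=> [_ _ [A [_ sA CA]] [B [_ sB CB]]]; split.
  by apply: Ck_sub CA => x ix; apply: sA; left.
by apply: Ck_sub CB => x ix; apply: sB; left.
Qed.

Lemma regular_derivable i u p x : regular Omega i u p -> interface Omega x ->
  [/\ derivable u x e0, {for x, continuous u} &
      {for x, continuous ('D_e0 u)}].
Proof.
move=> [[[A [_ sA CA]] _] _ _ _] hx; have Ax : A x by apply: sA; right.
split; [exact: Ck_derivable CA Ax|exact: Ck_continuous CA Ax|].
exact: Ck_continuous (Ck_derive _ CA) Ax.
Qed.

Lemma mirror_space i j u p : opposite i j -> V j u p ->
  V i (mirror_velocity u) (mirror_pressure p).
Proof.
by have [_ _ V12 V21] := hV; case=> -[-> ->]; [exact: V21|exact: V12].
Qed.

Lemma mirror_outer_boundary i j x : opposite i j ->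
  (boundary (subdomain Omega i) `\` interface Omega) x ->
  (boundary (subdomain Omega j) `\` interface Omega) (mirror x).
Proof.
move=> ij [bx nx]; split.
  apply: boundary_mirror.
  by rewrite (preimage_mirror_subdomain sOmega ij).
move=> [cx hx]; apply: nx; have hx' : hyperplane x.
  by move: hx; rewrite /hyperplane /= mirrorE mulN1r => /eqP; rewrite oppr_eq0 => /eqP.
by rewrite (mirror_hyperplane hx') in cx.
Qed.

(** The candidate [v] solves the update problem, as [mirror] keeps tangential traces and reverses
    the outward normal traction. Uniqueness gives [u' = v] only in the open half; continuity of the
    fields and of their [e0]-derivatives up to the interface gives both traces. The data put side
    [i] first so that one proof serves both sides. *)
Lemma symmetrized_update i j u w w' u' p q q' p' : opposite i j ->
  V i u p -> V i w q -> V j w' q' -> V i u' p' ->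
  stokes_equations nu (subdomain Omega i) f u p ->
  stokes_equations nu (subdomain Omega i) (fun=> 0) w q ->
  stokes_equations nu (subdomain Omega j) (fun=> 0) w' q' ->
  (forall x, (boundary (subdomain Omega i) `\` interface Omega) x -> u x = 0) ->
  (forall x, (boundary (subdomain Omega i) `\` interface Omega) x -> w x = 0) ->
  (forall x, (boundary (subdomain Omega j) `\` interface Omega) x -> w' x = 0) ->
  update_problem nu Omega i f
    (fun x => tangential_part i (u x) +
       2^-1 *: (tangential_part i (w x) + tangential_part j (w' x)))
    (fun x => sigma_n nu i u p x +
       2^-1 *: (sigma_n nu i w q x - sigma_n nu j w' q' x))
    u' p' ->
  forall x, interface Omega x ->
    u' x = u x + 2^-1 *: (w x + mirror (w' x)) /\
    'D_e0 u' x = 'D_e0 u x + 2^-1 *: ('D_e0 w x - mirror ('D_e0 w' x)).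
Proof.
move=> ij Vu Vw Vw' Vu' Su Sw Sw' bu bw bw' Pu'.
have [si sj] := opposite_side ij.
have [Vreg Vlin _ _] := hV.
(* The coefficient 1 matches the form in which [solution_spaces] is closed
   under combinations. *)
pose z x := 1 *: w x + mirror_velocity w' x.
pose zq x := 1 * q x + mirror_pressure q' x.
pose v x := 2^-1 *: z x + u x.
pose vp x := 2^-1 * zq x + p x.
have Vm : V i (mirror_velocity w') (mirror_pressure q') by exact: mirror_space Vw'.
have Vz : V i z zq by exact: Vlin.
have Vv : V i v vp by exact: Vlin.
have oi := @open_subdomain _ _ _ oOmega i.
have [Cu Cp] := regular_Ck (Vreg _ _ _ si Vu).
have [Cw Cq] := regular_Ck (Vreg _ _ _ si Vw).
have [Cw' Cq'] := regular_Ck (Vreg _ _ _ sj Vw').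
have [Cm Cmq] := regular_Ck (Vreg _ _ _ si Vm).
have [Cz Czq] := regular_Ck (Vreg _ _ _ si Vz).
have Sm : stokes_equations nu (subdomain Omega i) (fun=> 0)
    (mirror_velocity w') (mirror_pressure q').
  have := stokes_mirror (@open_subdomain _ _ _ oOmega j) Cw' Cq' Sw'.
  rewrite (preimage_mirror_subdomain sOmega ij) => S x Dx.
  by have [S1 S2] := S x Dx; split=> //; rewrite S1 /mirror_velocity mirror0.
have Sz : stokes_equations nu (subdomain Omega i) (fun=> 0) z zq.
  move=> x Dx; have [S1 S2] := stokes_combination 1 oi Cm Cw Cmq Cq Sw Sm Dx.
  by split=> //; rewrite S1 scaler0 addr0.
have Sv : stokes_equations nu (subdomain Omega i) f v vp.
  move=> x Dx; have [S1 S2] := stokes_combination 2^-1 oi Cu Cz Cp Czq Sz Su Dx.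
  by split=> //; rewrite S1 scaler0 add0r.
have vE x : interface Omega x -> v x = u x + 2^-1 *: (w x + mirror (w' x)).
  move=> [_ hx]; rewrite /v /z /mirror_velocity (mirror_hyperplane hx).
  by rewrite scale1r addrC.
have dvE x : interface Omega x ->
    'D_e0 v x = 'D_e0 u x + 2^-1 *: ('D_e0 w x - mirror ('D_e0 w' x)).
  move=> ix; have [_ hx] := ix.
  have [du _ _] := regular_derivable (Vreg _ _ _ si Vu) ix.
  have [dw _ _] := regular_derivable (Vreg _ _ _ si Vw) ix.
  have [dw' _ _] := regular_derivable (Vreg _ _ _ sj Vw') ix.
  have [dz _ _] := regular_derivable (Vreg _ _ _ si Vz) ix.
  have [_ ->] := is_derive_combination 2^-1 dz du.
  have dm : derivable w' (mirror x) e0 by rewrite (mirror_hyperplane hx).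
  have [dm' dmE] := is_derive_mirror_velocity_basis dm.
  have [_ ->] := is_derive_combination 1 dw dm'.
  rewrite dmE /mirror_velocity (mirror_hyperplane hx) eqxx expr1 scaleN1r scale1r.
  by rewrite addrC.
have Pv : update_problem nu Omega i f
    (fun x => tangential_part i (u x) +
       2^-1 *: (tangential_part i (w x) + tangential_part j (w' x)))
    (fun x => sigma_n nu i u p x +
       2^-1 *: (sigma_n nu i w q x - sigma_n nu j w' q' x)) v vp.
  split=> //.
  - move=> x ix; rewrite vE //; apply/rowP => k.
    rewrite [RHS]row_add [X in _ = _ + X]row_scale [X in _ = _ + _ * X]row_add.
    have [->|k0] := eqVneq k ord0.
      by rewrite !tangential_part0 !(addr0, mulr0).
    by rewrite !tangential_part_coord // !entryE mirrorE (negbTE k0) mul1r.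
  - move=> x ix; have [_ hx] := ix.
    have [du _ _] := regular_derivable (Vreg _ _ _ si Vu) ix.
    have [dw _ _] := regular_derivable (Vreg _ _ _ si Vw) ix.
    have [dw' _ _] := regular_derivable (Vreg _ _ _ sj Vw') ix.
    have [dv _ _] := regular_derivable (Vreg _ _ _ si Vv) ix.
    rewrite !sigma_nE // -scalerBl scalerA -scalerDl; congr (_ *: _).
    (* Opposite outward normals turn the difference of normal stresses into a sum of tractions. *)
    have -> : (-1) ^+ j.-1 = - (-1) ^+ i.-1 :> R.
      by case: ij => -[-> ->]; rewrite /= ?expr0 ?expr1 ?opprK.
    rewrite /normal_traction dvE // /vp /zq /mirror_pressure (mirror_hyperplane hx).
    (* In the normal entry the reversed direction and the reversed component compensate each
       other. *)
    have -> : ('D_e0 u x + 2^-1 *: ('D_e0 w x - mirror ('D_e0 w' x))) 0 ord0 =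
       'D_e0 u x 0 ord0 + 2^-1 * ('D_e0 w x 0 ord0 + 'D_e0 w' x 0 ord0).
      move: ('D_e0 u x) ('D_e0 w x) ('D_e0 w' x) => a b c.
      by rewrite !entryE mirrorE /= expr1 mulN1r opprK.
    by ring.
  - move=> x bx; rewrite /v /z bu // bw // /mirror_velocity.
    rewrite bw'; last exact: mirror_outer_boundary bx.
    by rewrite mirror0 scaler0 !addr0 scaler0.
have uv := hupdate si Vu' Vv Pu' Pv.
move=> x ix; have cx := interface_sub_closure oOmega sOmega si ix.
have [_ cu' cdu'] := regular_derivable (Vreg _ _ _ si Vu') ix.
have [_ cv cdv] := regular_derivable (Vreg _ _ _ si Vv) ix.
split; first by rewrite -vE //; exact: eq_at_closure cu' cv cx uv.
rewrite -dvE //; apply: eq_at_closure cdu' cdv cx _ => y Dy.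
exact: derive_eq_on oi Dy uv.
Qed.

End Update.

(** * Auxiliary facts on finite sums and closures *)

Lemma continuous_sum_at {R : realType} {T : topologicalType} n
    (F : 'I_n -> T -> R) x :
  (forall j, {for x, continuous (F j)}) ->
  {for x, continuous (fun y => \sum_(j < n) F j y)}.
Proof. by move=> cF; apply: cvg_big => [|j _]; [exact: add_continuous|exact: cF]. Qed.

(** Extracts the purely normal term from equal divergences or Laplacians once all other terms are
    matched. *)
Lemma sum_cancel {R : zmodType} n (F G : 'I_n.+1 -> R) :
  (forall k, k != ord0 -> F k = G k) ->
  \sum_(k < n.+1) F k = \sum_(k < n.+1) G k -> F ord0 = G ord0.
Proof.
move=> FG; rewrite (bigD1 ord0) //= [RHS](bigD1 ord0) //= (eq_bigr G FG).
by move/addIr.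
Qed.

Lemma closureI_open {T : topologicalType} (A B : set T) x :
  open B -> B x -> closure A x -> closure (A `&` B) x.
Proof.
move=> oB Bx cA C xC.
have [y [Ay [Cy By]]] := cA _ (filterI xC (open_nbhs_nbhs (conj oB Bx))).
by exists y.
Qed.

(** Inside the open set [B], the closures of [A] and of its intersection with [B] coincide, so
    continuity on the closure of one half suffices there. *)
Lemma cvg_within_closure_local {T : topologicalType} {S : topologicalType}
    (A B : set T) (f g : T -> S) x : open B -> B x ->
  (forall y, B y -> f y = g y) ->
  g @ within (closure (A `&` B)) (nbhs x) --> g x ->
  f @ within (closure A) (nbhs x) --> f x.
Proof.
move=> oB Bx fg gx N; rewrite (fg _ Bx) => /gx gN.
have gN' : \forall y \near x, closure (A `&` B) y -> N (g y) by exact: gN.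
change (\forall y \near x, closure A y -> N (f y)).
apply: filterS2 (open_nbhs_nbhs (conj oB Bx)) gN' => y By Ny Ay.
by rewrite fg //; apply: Ny; exact: closureI_open.
Qed.

(** * Matching across the interface and the glued Stokes solution *)

Section Interface.
Context {R : realType} {d : nat}.
Variables (nu : R) (Omega : set 'rV[R]_d.+1) (f : 'rV[R]_d.+1 -> 'rV[R]_d.+1).
Hypothesis nu_gt0 : 0 < nu.
Hypothesis oOmega : open Omega.
Hypothesis sOmega : forall x, Omega x -> Omega (mirror x).
Hypothesis cf : forall x, Omega x -> {for x, continuous f}.
Notation E := 'rV[R]_d.+1.
Notation e_ := (basis_vec R).
Notation e0 := (basis_vec R (ord0 : 'I_d.+1)).
Implicit Types (x : E) (u w : E -> E) (p q : E -> R) (i : nat) (j c : 'I_d.+1).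

Lemma laplacian_coord u x c :
  laplacian u x 0 c = \sum_(j < d.+1) 'D_(e_ j) ('D_(e_ j) u) x 0 c.
Proof. by rewrite /laplacian summxE. Qed.

Lemma gradient_coord p x c : gradient p x 0 c = 'D_(e_ c) p x.
Proof. by rewrite mxE. Qed.

Lemma momentum_coord (D : set E) u p x c : stokes_equations nu D f u p -> D x ->
  - (nu * \sum_(j < d.+1) 'D_(e_ j) ('D_(e_ j) u) x 0 c) - 'D_(e_ c) p x =
  f x 0 c.
Proof.
move=> S Dx; have [<- _] := S x Dx.
by rewrite !entryE laplacian_coord gradient_coord.
Qed.

Lemma momentum_cancel (a b r s : R) : r = s ->
  - (nu * a) - r = - (nu * b) - s -> a = b.
Proof. by move=> -> /addIr/oppr_inj/(mulfI (lt0r_neq0 nu_gt0)). Qed.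

Lemma momentum_cancelr (a b r s : R) : a = b ->
  - (nu * a) - r = - (nu * b) - s -> r = s.
Proof. by move=> -> /addrI/oppr_inj. Qed.

Lemma stokes_eq_on (D : set E) u w p q : open D ->
  (forall x, D x -> u x = w x) -> (forall x, D x -> p x = q x) ->
  stokes_equations nu D f u p -> stokes_equations nu D f w q.
Proof.
move=> oD uw pq S x Dx; have [S1 S2] := S x Dx.
have D1 y j : D y -> 'D_(e_ j) w y = 'D_(e_ j) u y.
  by move=> Dy; apply/esym; exact: derive_eq_on uw.
have D2 j : 'D_(e_ j) ('D_(e_ j) w) x = 'D_(e_ j) ('D_(e_ j) u) x.
  by apply: (derive_eq_on _ oD Dx) => y; exact: D1.
have lapE : laplacian w x = laplacian u x by apply: eq_bigr => j _; exact: D2.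
have gradE : gradient q x = gradient p x.
  apply/rowP => j; rewrite !gradient_coord; apply/esym.
  exact: derive_eq_on pq.
have divE : divergence w x = divergence u x.
  by apply: eq_bigr => j _; exact: (congr1 (fun a : E => a 0 j) (D1 x j Dx)).
split; last exact: etrans divE S2.
exact: etrans (congr2 (fun a b : E => - (nu *: a) - b) lapE gradE) S1.
Qed.

(** All terms are continuous up to the part of the interface inside [Omega], so the equations pass
    to the limit from the open half. The last identity is the normal derivative of the divergence
    constraint. *)
Lemma interface_equations i u p : is_side i -> regular Omega i u p ->
  stokes_equations nu (subdomain Omega i) f u p ->
  stokes_equations nu (Omega `&` @hyperplane R d) f u p /\
  (forall x, (Omega `&` @hyperplane R d) x ->
    \sum_(j < d.+1) 'D_e0 ('D_(e_ j) u) x 0 j = 0).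
Proof.
move=> si [_ _ [A [oA sA CA]] [B [_ sB CB]]] S.
have oi := @open_subdomain _ _ _ oOmega i.
have iA x : subdomain Omega i x -> A x by move=> ix; apply: sA; left.
have ix x : (Omega `&` @hyperplane R d) x -> interface Omega x.
  by move=> [Ox hx]; split=> //; exact: subset_closure.
have Ax x : (Omega `&` @hyperplane R d) x -> A x.
  by move=> hx; apply: sA; right; split; [exact: ix|case: hx].
have Bx x : (Omega `&` @hyperplane R d) x -> B x.
  by move=> hx; apply: sB; right; split; [exact: ix|case: hx].
have cx x : (Omega `&` @hyperplane R d) x -> closure (subdomain Omega i) x.
  by move=> /ix; exact: interface_sub_closure.
have cD2 x a b c : A x -> {for x, continuous (fun y => 'D_(e_ a) ('D_(e_ b) u) y 0 c)}.
  move=> xA; apply: continuous_entry.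
  exact: Ck_continuous (Ck_derive _ (Ck_derive _ CA)) xA.
have cD1 x a c : A x -> {for x, continuous (fun y => 'D_(e_ a) u y 0 c)}.
  by move=> xA; apply: continuous_entry; exact: Ck_continuous (Ck_derive _ CA) xA.
split=> x hx; last first.
  apply: (@eq_at_closure R E R (fun y => \sum_(j < d.+1) 'D_e0 ('D_(e_ j) u) y 0 j)
    (fun=> 0) (subdomain Omega i)); [|exact: cst_continuous|exact: cx|].
    by apply: continuous_sum_at => j; apply: cD2; exact: Ax.
  move=> y Dy.
  have dj j : derivable (fun z => 'D_(e_ j) u z 0 j) y e0.
    have dD : derivable ('D_(e_ j) u) y e0.
      exact: Ck_derivable (Ck_derive _ CA) (iA _ Dy).
    by move/derivable_mxP : dD; apply.
  (* In the open half the divergence is locally the zero function, which can be differentiated. *)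
  transitivity ('D_e0 (divergence u) y); last first.
    have -> : 'D_e0 (divergence u) y = 'D_e0 (cst 0 : E -> R) y.
      by apply: (derive_eq_on _ oi Dy) => z Dz; have [] := S z Dz.
    exact: derive_cst.
  have -> : divergence u = \sum_(j < d.+1) (fun z => 'D_(e_ j) u z 0 j).
    by apply/funext => z; rewrite fct_sumE.
  rewrite derive_sum //; apply: eq_bigr => j _; rewrite derive_coord //.
  exact: Ck_derivable (Ck_derive _ CA) (iA _ Dy).
split.
  apply/rowP => c; rewrite !entryE laplacian_coord gradient_coord.
  apply: (@eq_at_closure R E R (fun y =>
    - (nu * \sum_(j < d.+1) 'D_(e_ j) ('D_(e_ j) u) y 0 c) - 'D_(e_ c) p y)
    (fun y => f y 0 c) (subdomain Omega i)); [| |exact: cx|].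
  - have cP := Ck_continuous (Ck_derive c CB) (Bx _ hx).
    have cL : {for x, continuous (fun y =>
        \sum_(j < d.+1) 'D_(e_ j) ('D_(e_ j) u) y 0 c)}.
      by apply: continuous_sum_at => j; apply: cD2; exact: Ax.
    have cnu : {for x, continuous (fun=> nu : R)} by exact: cst_continuous.
    exact: (continuousB (continuousN (continuousM cnu cL)) cP).
  - by apply: continuous_entry; apply: cf; case: hx.
  - by move=> y; exact: momentum_coord S.
apply: (@eq_at_closure R E R (divergence u) (fun=> 0) (subdomain Omega i));
  [|exact: cst_continuous|exact: cx|].
  by apply: continuous_sum_at => j; apply: cD1; exact: Ax.
by move=> y Dy; have [] := S y Dy.
Qed.

Lemma interface_agree u w p q : regular Omega 1 u p -> regular Omega 2 w q ->
  stokes_equations nu (subdomain Omega 1) f u p ->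
  stokes_equations nu (subdomain Omega 2) f w q ->
  (forall x, interface Omega x -> u x = w x) ->
  (forall x j, interface Omega x -> j != ord0 ->
    'D_e0 u x 0 j = 'D_e0 w x 0 j) ->
  (forall x, interface Omega x ->
    normal_traction nu u p x = normal_traction nu w q x) ->
  agree 2 (Omega `&` @hyperplane R d) u w /\
  agree 1 (Omega `&` @hyperplane R d) p q.
Proof.
move=> ru rw Su Sw uw duw tuw.
have [Iu Tu] := interface_equations (or_introl erefl) ru Su.
have [Iw Tw] := interface_equations (or_intror erefl) rw Sw.
set D := Omega `&` @hyperplane R d.
have ix x : D x -> interface Omega x.
  by move=> [Ox hx]; split=> //; exact: subset_closure.
have tang (W : normedModType R) (g h : E -> W) :
    (forall x, D x -> g x = h x) ->
    forall x j, D x -> j != ord0 -> 'D_(e_ j) g x = 'D_(e_ j) h x.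
  move=> gh x j [Ox hx] j0; apply: (derive_tangential oOmega j0) => // y Oy hy.
  exact: gh.
have uwD x : D x -> u x = w x by move=> /ix; exact: uw.
(* Tangential derivatives follow from equal values on the hyperplane. For the normal derivative, the
   tangential entries are given and the normal entry comes from the divergence. *)
have D1 x j : D x -> 'D_(e_ j) u x = 'D_(e_ j) w x.
  move=> Dx; have [->|j0] := eqVneq j ord0; last exact: (tang _ _ _ uwD).
  apply/rowP => c; have [->|c0] := eqVneq c ord0; last exact: duw (ix _ Dx) c0.
  have : divergence u x = divergence w x.
    by have [_ ->] := Iu x Dx; have [_ ->] := Iw x Dx.
  apply: (@sum_cancel R d (fun k => 'D_(e_ k) u x 0 k)
    (fun k => 'D_(e_ k) w x 0 k)) => k k0.
  exact: (congr1 (fun a : E => a 0 k) (tang _ _ _ uwD x k Dx k0)).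
have pqD x : D x -> p x = q x.
  move=> Dx; have := tuw x (ix _ Dx); rewrite /normal_traction (D1 x ord0 Dx).
  by move/addrI.
have D2t x (i j : 'I_d.+1) : D x -> i != ord0 ->
    'D_(e_ i) ('D_(e_ j) u) x = 'D_(e_ i) ('D_(e_ j) w) x.
  by move=> Dx i0; apply: tang Dx i0 => y; exact: D1.
(* Schwarz's theorem moves the tangential derivative outside, where it acts on first derivatives
   already equal on the hyperplane. *)
have D2m x j : D x -> j != ord0 -> 'D_e0 ('D_(e_ j) u) x = 'D_e0 ('D_(e_ j) w) x.
  move=> Dx j0; have [_ _ [A [oA sA CA]] _] := ru; have [_ _ [B [oB sB CB]] _] := rw.
  have Ax : A x by apply: sA; right; split; [exact: ix|case: Dx].
  have Bx : B x by apply: sB; right; split; [exact: ix|case: Dx].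
  apply: (etrans (Ck_derive_symmetric _ _ oA Ax CA)).
  apply: (etrans (D2t x j ord0 Dx j0)).
  exact: (Ck_derive_symmetric _ _ oB Bx CB).
(* The normal entry comes from the differentiated divergence; a tangential entry [c] from the
   momentum equation, where the pressure derivative along [c] is tangential and hence already
   matched. *)
have D2n x : D x -> 'D_e0 ('D_e0 u) x = 'D_e0 ('D_e0 w) x.
  move=> Dx; apply/rowP => c; have [->|c0] := eqVneq c ord0.
    have := etrans (Tu x Dx) (esym (Tw x Dx)).
    apply: (@sum_cancel R d (fun k => 'D_e0 ('D_(e_ k) u) x 0 k)
      (fun k => 'D_e0 ('D_(e_ k) w) x 0 k)) => k k0.
    exact: (congr1 (fun a : E => a 0 k) (D2m x k Dx k0)).
  have := etrans (momentum_coord c Iu Dx) (esym (momentum_coord c Iw Dx)).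
  move=> /(momentum_cancel (tang _ _ _ pqD x c Dx c0)).
  apply: (@sum_cancel R d (fun k => 'D_(e_ k) ('D_(e_ k) u) x 0 c)
    (fun k => 'D_(e_ k) ('D_(e_ k) w) x 0 c)) => k k0.
  exact: (congr1 (fun a : E => a 0 c) (D2t x k k Dx k0)).
have D2 x (i j : 'I_d.+1) : D x -> 'D_(e_ i) ('D_(e_ j) u) x = 'D_(e_ i) ('D_(e_ j) w) x.
  move=> Dx; have [->|i0] := eqVneq i ord0; last exact: D2t.
  by have [->|j0] := eqVneq j ord0; [exact: D2n|exact: D2m].
(* The Laplacians now agree, so the momentum equation gives the normal derivative of the pressure as
   well. *)
have P1 x j : D x -> 'D_(e_ j) p x = 'D_(e_ j) q x.
  move=> Dx.
  have sumE : \sum_(k < d.+1) 'D_(e_ k) ('D_(e_ k) u) x 0 j =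
            \sum_(k < d.+1) 'D_(e_ k) ('D_(e_ k) w) x 0 j.
    apply: eq_bigr => k _.
    exact: (congr1 (fun a : E => a 0 j) (D2 x k k Dx)).
  have := etrans (momentum_coord j Iu Dx) (esym (momentum_coord j Iw Dx)).
  exact: (momentum_cancelr sumE).
split.
  split; first exact: uwD.
  move=> j; split=> [x|i]; first exact: D1.
  by split=> [x|]; [exact: D2|exact: I].
split; first exact: pqD.
by move=> j; split=> [x|]; [exact: P1|exact: I].
Qed.

Lemma glued_stokes_solution u w p q : no_slit Omega ->
  regular Omega 1 u p -> regular Omega 2 w q ->
  stokes_equations nu (subdomain Omega 1) f u p ->
  stokes_equations nu (subdomain Omega 2) f w q ->
  (forall x, (boundary (subdomain Omega 1) `\` interface Omega) x -> u x = 0) ->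
  (forall x, (boundary (subdomain Omega 2) `\` interface Omega) x -> w x = 0) ->
  (forall x, interface Omega x -> u x = w x) ->
  (forall x j, interface Omega x -> j != ord0 ->
    'D_e0 u x 0 j = 'D_e0 w x 0 j) ->
  (forall x, interface Omega x ->
    normal_traction nu u p x = normal_traction nu w q x) ->
  stokes_solution nu Omega f (glue u w) (glue p q).
Proof.
move=> hslit ru rw Su Sw bu bw uw duw tuw.
have [auw apq] := interface_agree ru rw Su Sw uw duw tuw.
have [Iw _] := interface_equations (or_intror erefl) rw Sw.
have [_ cu [A [oA sA CA]] [A' [oA' sA' CA']]] := ru.
have [_ cw [B [oB sB CB]] [B' [oB' sB' CB']]] := rw.
have left x : Omega x -> x 0 ord0 <= 0 ->
    (subdomain Omega 1 `|` (interface Omega `&` Omega)) x.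
  move=> Ox; rewrite le_eqVlt => /orP[/eqP x0|x0]; last by left.
  by right; split=> //; split=> //; exact: subset_closure.
have right x : Omega x -> 0 <= x 0 ord0 ->
    (subdomain Omega 2 `|` (interface Omega `&` Omega)) x.
  move=> Ox; rewrite le_eqVlt => /orP[/eqP x0|x0]; last by left.
  by right; split=> //; split=> //; exact: subset_closure.
have OA x : Omega x -> x 0 ord0 <= 0 -> A x by move=> Ox /(left _ Ox) /sA.
have OA' x : Omega x -> x 0 ord0 <= 0 -> A' x by move=> Ox /(left _ Ox) /sA'.
have OB x : Omega x -> 0 <= x 0 ord0 -> B x by move=> Ox /(right _ Ox) /sB.
have OB' x : Omega x -> 0 <= x 0 ord0 -> B' x by move=> Ox /(right _ Ox) /sB'.
have cglue x : interface Omega x -> {for x, continuous (glue u w)}.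
  move=> hx; apply: continuous_glue => [_|_|_]; last exact: uw.
  - by have [] := regular_derivable ru hx.
  - by have [] := regular_derivable rw hx.
(* Off the hyperplane, a boundary point of [Omega] is a boundary point of the half on its side:
   closure is local, and a point interior to the half is interior to [Omega]. *)
have zero x : boundary Omega x -> x 0 ord0 != 0 -> glue u w x = 0.
  move=> [cx nx]; have notI : x 0 ord0 != 0 -> ~ interface Omega x.
    by move=> /eqP x0 [_ /x0].
  rewrite neq_lt => /orP[x0|x0].
    rewrite glue_left //; apply: bu; split; last by apply: notI; rewrite lt_eqF.
    split; first exact: closureI_open (@open_left R d) x0 cx.
    by move=> sx; apply: nx; apply: filterS sx => y [].
  rewrite glue_right ?ltW //; apply: bw; split; last by apply: notI; rewrite gt_eqF.
  split; first exact: closureI_open (@open_right R d) x0 cx.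
  by move=> sx; apply: nx; apply: filterS sx => y [].
split.
- exact: Ck_glue CA CB auw.
- exact: Ck_glue CA' CB' apq.
- apply/subspace_continuousP => x cx; have [x0|x0|x0] := ltgtP (x 0 ord0) 0.
  + have ul (y : E) : y 0 ord0 < 0 -> glue u w y = u y by exact: glue_left.
    apply: (cvg_within_closure_local (@open_left R d) x0 ul).
    move/subspace_continuousP : cu; apply.
    exact: closureI_open (@open_left R d) x0 cx.
  + have wr (y : E) : 0 < y 0 ord0 -> glue u w y = w y.
      by move=> /ltW; exact: glue_right.
    apply: (cvg_within_closure_local (@open_right R d) x0 wr).
    move/subspace_continuousP : cw; apply.
    exact: closureI_open (@open_right R d) x0 cx.
  + by apply: cvg_within_filter; apply: cglue.
- move=> x Ox; have [x0|x0|x0] := ltgtP (x 0 ord0) 0.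
  + apply: (stokes_eq_on (@open_subdomain _ _ _ oOmega 1) _ _ Su); last by split.
      by move=> y [_ y0]; rewrite glue_left.
    by move=> y [_ y0]; rewrite glue_left.
  + apply: (stokes_eq_on (@open_subdomain _ _ _ oOmega 2) _ _ Sw); last by split.
      by move=> y [_ /ltW y0]; rewrite glue_right.
    by move=> y [_ /ltW y0]; rewrite glue_right.
  (* On the hyperplane the glued derivatives take the values of the second field, so its interface
     equations [Iw] apply. *)
  + have Dx : (Omega `&` @hyperplane R d) x by split.
    have x0' : 0 <= x 0 ord0 by rewrite x0.
    have d1 y j : Omega y -> 'D_(e_ j) (glue u w) y = glue ('D_(e_ j) u) ('D_(e_ j) w) y.
      by move=> Oy; have [_] := derive_glue j OA OB CA CB auw Oy.
    have d2 j : 'D_(e_ j) ('D_(e_ j) (glue u w)) x = 'D_(e_ j) ('D_(e_ j) w) x.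
      apply: (etrans (derive_eq_on _ oOmega Ox (fun y => @d1 y j))).
      have [_ eq] := derive_glue j OA OB (Ck_derive j CA) (Ck_derive j CB)
        (proj2 auw j) Ox.
      by apply: (etrans eq); rewrite glue_right.
    have [S1 S2] := Iw x Dx; split.
      have -> : laplacian (glue u w) x = laplacian w x.
        by apply: eq_bigr => j _; exact: d2.
      suff -> : gradient (glue p q) x = gradient q x by [].
      apply/rowP => j; rewrite !gradient_coord.
      have [_ eq] := derive_glue j OA' OB' CA' CB' apq Ox.
      by apply: (etrans eq); rewrite glue_right.
    apply: (etrans _ S2); apply: eq_bigr => j _.
    apply: (congr1 (fun a : E => a 0 j)); apply: (etrans (d1 x j Ox)).
    by rewrite glue_right.
- move=> x bx; have [hx|/eqP x0] := pselect (x 0 ord0 = 0); last exact: zero.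
  (* By [no_slit] a boundary point on the hyperplane is a limit of boundary points off it, where the
     glued velocity vanishes; it is continuous at the interface. *)
  apply: (@eq_at_closure _ _ _ (glue u w) (fun=> 0) (boundary Omega `\` @hyperplane R d)).
  + by apply: cglue; split=> //; case: bx.
  + exact: cst_continuous.
  + by apply: hslit; split.
  + by move=> y [by_ /eqP y0]; exact: zero.
Qed.

End Interface.

(** * Invariant of the algorithm and convergence in two steps *)

Definition balanced {R : realType} {d : nat} (nu : R) (Omega : set 'rV[R]_d.+1)
    (u1 u2 : 'rV[R]_d.+1 -> 'rV[R]_d.+1) (p1 p2 : 'rV[R]_d.+1 -> R) : Prop :=
  forall x, interface Omega x ->
    tangential_part 1 (u1 x) = tangential_part 2 (u2 x) /\
    sigma_n nu 1 u1 p1 x = - sigma_n nu 2 u2 p2 x.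

(** Both sides receive the same tangential increment and opposite normal stress increments. *)
Lemma update_step_balanced {R : realType} {d : nat} (nu : R)
    (Omega : set 'rV[R]_d.+1) f k u p w q :
  update_step nu Omega f k u p w q ->
  balanced nu Omega (u 1%N k) (u 2%N k) (p 1%N k) (p 2%N k) ->
  balanced nu Omega (u 1%N k.+1) (u 2%N k.+1) (p 1%N k.+1) (p 2%N k.+1).
Proof.
move=> upd bal x ix; have [tb sb] := bal x ix.
have [_ T1 S1 _] := upd 1%N (or_introl erefl).
have [_ T2 S2 _] := upd 2%N (or_intror erefl).
split; first by rewrite (T1 x ix) (T2 x ix) tb.
rewrite (S1 x ix) (S2 x ix) sb /= expr0 expr1 mul1r mulN1r scaleNr.
by rewrite opprB addrC.
Qed.

(** The sum of the two outward stresses is a difference of [e0]-derivatives, the normals being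
    opposite; divide by [nu]. *)
Lemma tangential_correction {R : realType} {d : nat} (nu : R) i
    (w u1 u2 : 'rV[R]_d.+1 -> 'rV[R]_d.+1) (q p1 p2 : 'rV[R]_d.+1 -> R) x j :
  0 < nu ->
  derivable w x (basis_vec R ord0) -> derivable u1 x (basis_vec R ord0) ->
  derivable u2 x (basis_vec R ord0) -> j != ord0 ->
  sigma_tau nu i w q x =
    - (2^-1 *: (sigma_tau nu 1 u1 p1 x + sigma_tau nu 2 u2 p2 x)) ->
  (-1) ^+ i.-1 * 'D_(basis_vec R ord0) w x 0 j =
    - (2^-1 * ('D_(basis_vec R ord0) u1 x 0 j - 'D_(basis_vec R ord0) u2 x 0 j)).
Proof.
move=> nu0 dw du1 du2 j0 /(congr1 (fun a : 'rV[R]_d.+1 => a 0 j)).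
rewrite (sigma_tau_coord _ _ _ dw j0) row_opp row_scale row_add.
rewrite (sigma_tau_coord _ _ _ du1 j0) (sigma_tau_coord _ _ _ du2 j0).
move: ('D_(basis_vec R ord0) w x 0 j) ('D_(basis_vec R ord0) u1 x 0 j) => a b.
move: ('D_(basis_vec R ord0) u2 x 0 j) => c.
rewrite /= expr0 expr1 mul1r mulN1r mulrCA => E.
by apply: (mulfI (lt0r_neq0 nu0)); rewrite E; ring.
Qed.

Theorem mainTheorem1 (R : realType) (d : nat)
  (hd : d.+1 = 2%N \/ d.+1 = 3%N)
  (nu : R) (hnu : 0 < nu)
  (Omega : set 'rV[R]_d.+1)
  (hopen : open Omega)
  (hsym : forall x, Omega x -> Omega (mirror x))
  (hslit : no_slit Omega)
  (f : 'rV[R]_d.+1 -> 'rV[R]_d.+1)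
  (hf : forall x, Omega x -> {for x, continuous f})
  (V : nat -> ('rV[R]_d.+1 -> 'rV[R]_d.+1) -> ('rV[R]_d.+1 -> R) -> Prop)
  (hV : solution_spaces Omega V)
  (hcorrection : correction_unique nu Omega V)
  (hupdate : update_unique nu Omega f V)
  (u w : nat -> nat -> 'rV[R]_d.+1 -> 'rV[R]_d.+1)
  (p q : nat -> nat -> 'rV[R]_d.+1 -> R)
  (hinit : initial_guess nu Omega u p)
  (hup : forall i k, is_side i -> V i (u i k.+1) (p i k.+1))
  (hwq : forall i k, is_side i -> V i (w i k.+1) (q i k.+1))
  (hcorr : forall k, correction_step nu Omega k u p w q)
  (hupd : forall k, update_step nu Omega f k u p w q) :
  exists (U : 'rV[R]_d.+1 -> 'rV[R]_d.+1) (P : 'rV[R]_d.+1 -> R),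
    stokes_solution nu Omega f U P /\
    forall i, is_side i -> forall x, subdomain Omega i x ->
      u i 2%N x = U x /\ p i 2%N x = P x.
Proof.
have s1 : is_side 1 by left.
have s2 : is_side 2 by right.
have [Vreg _ _ _] := hV.
have bal k : balanced nu Omega (u 1%N k) (u 2%N k) (p 1%N k) (p 2%N k).
  elim: k => [|k IH]; first by case: hinit.
  exact: update_step_balanced (hupd k) IH.
have [Su1 _ _ bu1] := hupd 0%N 1%N s1.
have [Su2 _ _ bu2] := hupd 0%N 2%N s2.
have [Sw1 nw1 tw1 bw1] := hcorr 1%N 1%N s1.
have [Sw2 nw2 tw2 bw2] := hcorr 1%N 2%N s2.
have [S1 T1 N1 b1] := hupd 1%N 1%N s1.
have [S2 T2 N2 b2] := hupd 1%N 2%N s2.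
(* The comparison is made at the second update because [u i 1] solves the Stokes equations with the
   outer boundary condition, whereas the initial guess is only known through its traces. *)
have E1 x : interface Omega x ->
    u 1%N 2%N x = u 1%N 1%N x + 2^-1 *: (w 1%N 2%N x + mirror (w 2%N 2%N x)) /\
    'D_(basis_vec R ord0) (u 1%N 2%N) x = 'D_(basis_vec R ord0) (u 1%N 1%N) x +
      2^-1 *: ('D_(basis_vec R ord0) (w 1%N 2%N) x -
               mirror ('D_(basis_vec R ord0) (w 2%N 2%N) x)).
  apply: (symmetrized_update hopen hsym hV hupdate (or_introl (conj erefl erefl))
    (hup _ _ s1) (hwq _ _ s1) (hwq _ _ s2) (hup _ _ s1) Su1 Sw1 Sw2 bu1 bw1 bw2).
  split=> // y iy; rewrite N1 //=; congr (_ + _ *: _); exact: mul1r.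
have E2 x : interface Omega x ->
    u 2%N 2%N x = u 2%N 1%N x + 2^-1 *: (w 2%N 2%N x + mirror (w 1%N 2%N x)) /\
    'D_(basis_vec R ord0) (u 2%N 2%N) x = 'D_(basis_vec R ord0) (u 2%N 1%N) x +
      2^-1 *: ('D_(basis_vec R ord0) (w 2%N 2%N) x -
               mirror ('D_(basis_vec R ord0) (w 1%N 2%N) x)).
  apply: (symmetrized_update hopen hsym hV hupdate (or_intror (conj erefl erefl))
    (hup _ _ s2) (hwq _ _ s2) (hwq _ _ s1) (hup _ _ s2) Su2 Sw2 Sw1 bu2 bw2 bw1).
  split=> // y iy; first by rewrite T2 // [X in _ *: X]addrC.
  by rewrite N2 //= expr1 mulN1r scaleNr -scalerN opprB.
exists (glue (u 1%N 2%N) (u 2%N 2%N)), (glue (p 1%N 2%N) (p 2%N 2%N)).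
split; last first.
  move=> i [->|->] x [_ /= x0]; first by rewrite !glue_left.
  by rewrite !glue_right // ltW.
have der i k x : is_side i -> interface Omega x ->
    derivable (u i k.+1) x (basis_vec R ord0) /\
    derivable (w i k.+1) x (basis_vec R ord0).
  move=> si ix; have [du _ _] := regular_derivable (Vreg _ _ _ si (hup i k si)) ix.
  by have [dw _ _] := regular_derivable (Vreg _ _ _ si (hwq i k si)) ix.
apply: (glued_stokes_solution hnu hopen hsym hf hslit
  (Vreg _ _ _ s1 (hup _ _ s1)) (Vreg _ _ _ s2 (hup _ _ s2)) S1 S2 b1 b2).
(* In the normal entry, the correction data give a difference [w_1 - w_2] equal to [- (u_1 - u_2)],
   which removes the jump. The tangential entries receive the same increment and were equal by
   [bal]. *)
- move=> x ix; have [-> _] := E1 x ix; have [-> _] := E2 x ix.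
  have [tb _] := bal 1%N x ix.
  apply/rowP => j; rewrite !entryE !mirrorE.
  have [->|j0] := eqVneq j ord0.
    have := congr1 (fun a : 'rV[R]_d.+1 => a 0 ord0) (nw1 x ix).
    have := congr1 (fun a : 'rV[R]_d.+1 => a 0 ord0) (nw2 x ix).
    rewrite !normal_partE !entryE !mxE /= !mulr1 expr1 sqrrN expr1n => -> ->.
    by field.
  have := congr1 (fun a : 'rV[R]_d.+1 => a 0 j) tb.
  by rewrite !tangential_part_coord // => ->; rewrite !mul1r [X in _ * X]addrC.
(* The same cancellation for tangential entries of the normal derivatives: the jump of the
   corrections is the opposite of the jump of the first iterates. *)
- move=> x j ix j0; have [_ ->] := E1 x ix; have [_ ->] := E2 x ix.
  have [du1 _] := der 1%N 0%N x s1 ix; have [du2 _] := der 2%N 0%N x s2 ix.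
  have [_ dw1] := der 1%N 1%N x s1 ix; have [_ dw2] := der 2%N 1%N x s2 ix.
  have := tangential_correction hnu dw1 du1 du2 j0 (tw1 x ix).
  have := tangential_correction hnu dw2 du1 du2 j0 (tw2 x ix).
  move: ('D_(basis_vec R ord0) (u 1%N 1%N) x) => a.
  move: ('D_(basis_vec R ord0) (u 2%N 1%N) x) => b.
  move: ('D_(basis_vec R ord0) (w 1%N 2%N) x) => c.
  move: ('D_(basis_vec R ord0) (w 2%N 2%N) x) => e.
  rewrite /= expr0 expr1 mul1r mulN1r !entryE !mirrorE (negbTE j0).
  by rewrite expr0 !mul1r => e2 e1; lra.
(* Opposite outward normal stresses mean equal tractions along the fixed normal. *)
- move=> x ix; have [du1 _] := der 1%N 1%N x s1 ix.
  have [du2 _] := der 2%N 1%N x s2 ix.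
  have [_ sb] := bal 2%N x ix; move: sb.
  rewrite !sigma_nE // => /(congr1 (fun a : 'rV[R]_d.+1 => a 0 ord0)).
  by rewrite !mxE /= !mulr1 expr0 expr1 mul1r mulN1r opprK.
Qed.
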